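(* Let $1<p<\infty$ and $\varepsilon>0$. (a) If $X$ is a quotient of $C_p$, then there is a subspace $X_0$ of $C_p$ with $d(X,X_0)<1+\varepsilon$. (b) If $X$ is a closed subspace of $C_p$, then there is a quotient $X_0$ of $C_p$ with $d(X,X_0)<1+\varepsilon$.
   Context: $d(X,Y)=\inf\|T\|\,\|T^{-1}\|$, over all surjective isomorphisms $T:X\to Y$, is the Banach–Mazur distance. Fix a sequence $(E_n)$ of finite-dimensional Banach spaces that is dense in the class of all finite-dimensional Banach spaces in the sense of Banach–Mazur distance (for every finite-dimensional $F$ and $\varepsilon>0$ there is $n$ with $d(E_n,F)<1+\varepsilon$). $C_p=\ell_p(E_n)$ is the $\ell_p$-direct sum of the $E_n$. (Different choices of $(E_n)$ give spaces at Banach–Mazur distance $1$.) A quotient means a quotient by a closed subspace. *)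

(* Defs.v *)
From HB Require Import structures.
From mathcomp Require Import all_boot all_order all_algebra.
From mathcomp Require Import generic_quotient ring_quotient.
From mathcomp Require Import all_classical all_reals all_analysis.

Set Implicit Arguments.
Unset Strict Implicit.
Unset Printing Implicit Defensive.

Import Order.TTheory GRing.Theory Num.Theory.
Import numFieldNormedType.Exports.

Local Open Scope classical_set_scope.
Local Open Scope ring_scope.
Local Open Scope quotient_scope.

Definition finite_dimensional (R : realType) (V : normedModType R) : Prop :=
  exists (n : nat) (b : 'I_n -> V),
    forall v : V, exists c : 'I_n -> R, v = \sum_(i < n) c i *: b i.

Definition opnorm (R : realType) (X Y : normedModType R) (T : X -> Y) : \bar R :=
  ereal_sup [set `|T x|%:E | x in [set x : X | `|x| <= 1]].

(* The infimum is +oo when X and Y are not isomorphic. *)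
Definition BMdist (R : realType) (X Y : normedModType R) : \bar R :=
  ereal_inf [set d | exists (T : {linear X -> Y}) (S : {linear Y -> X}),
    [/\ continuous T, continuous S, cancel T S, cancel S T
      & d = (opnorm T * opnorm S)%E]].

Definition BMdense (R : realType) (E : nat -> completeNormedModType R) : Prop :=
  forall F : completeNormedModType R, finite_dimensional F ->
  forall eps : R, 0 < eps -> exists n, (BMdist (E n) F < (1 + eps)%:E)%E.

Definition lp_enorm (R : realType) (E : nat -> normedModType R) (p : R)
    (x : forall n, E n) : \bar R :=
  ((\sum_(n <oo) (`|x n| `^ p)%:E) `^ p^-1)%E.

(* The type depends on the proof of 1 <= p so that its normed space structure
   can be inferred. *)
Record lp_sum (R : realType) (E : nat -> normedModType R) (p : R)
    (p1 : 1 <= p) := LpSum {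
  lp_val :> forall n, E n;
  lp_val_fin : (lp_enorm p lp_val < +oo)%E }.

Section lp_sum_normed.
Context (R : realType) (E : nat -> normedModType R) (p : R) (p1 : 1 <= p).
Local Notation L := (lp_sum E p1).

Let p0 : 0 < p. Proof. exact: lt_le_trans p1. Qed.

Lemma lp_val_inj (x y : L) : (forall n, x n = y n) -> x = y.
Proof.
case: x y => [x xP] [y yP] /= xy.
have {}xy : x = y by apply: functional_extensionality_dep.
by subst y; congr LpSum; exact: Prop_irrelevance.
Qed.

Lemma lp_enormE (x : forall n, E n) :
  lp_enorm p x = ('N[counting]_p%:E[EFin \o (fun n => `|x n|%R)])%E.
Proof.
rewrite Lnorm_counting// /lp_enorm; congr (_ `^ _)%E.
by apply: eq_eseriesr => n _; rewrite /= normr_id.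
Qed.

Lemma lp_enorm_ge0 (x : forall n, E n) : (0 <= lp_enorm p x)%E.
Proof. exact: poweR_ge0. Qed.

Lemma lp_enorm_le (x : forall n, E n) (f : nat -> R) :
  (forall n, `|x n| <= f n) -> (lp_enorm p x <= 'N[counting]_p%:E[EFin \o f])%E.
Proof.
move=> xf; rewrite Lnorm_counting// /lp_enorm.
have s0 (g : nat -> \bar R) : (forall n, 0 <= g n)%E -> (0 <= \sum_(n <oo) g n)%E.
  by move=> g0; apply: nneseries_ge0 => n _ _; exact: g0.
apply: gt0_ler_poweR; rewrite ?invr_ge0 ?(ltW p0)//.
- by rewrite in_itv/= leey andbT s0// => n; rewrite lee_fin powR_ge0.
- by rewrite in_itv/= leey andbT s0// => n; exact: poweR_ge0.
apply: lee_nneseries => [n _ _|n _]; first by rewrite lee_fin powR_ge0.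
rewrite /= lee_fin ge0_ler_powR ?nnegrE ?(ltW p0)//.
by rewrite (le_trans (xf n))// ler_norm.
Qed.

Lemma lp_enormD (x y : forall n, E n) :
  (lp_enorm p (fun n => x n + y n)%R <= lp_enorm p x + lp_enorm p y)%E.
Proof.
rewrite (lp_enormE x) (lp_enormE y).
apply: le_trans (minkowski_EFin _ _ _ _) => //.
by apply: lp_enorm_le => n; exact: ler_normD.
Qed.

Lemma lp_enormZ (a : R) (x : forall n, E n) :
  lp_enorm p (fun n => a *: x n) = (`|a|%:E * lp_enorm p x)%E.
Proof.
have t0 (n : nat) : (0 <= (`|x n| `^ p)%:E)%E by rewrite lee_fin powR_ge0.
have sZ : (\sum_(n <oo) (`|(a *: x n)%R| `^ p)%:E =
    (`|a| `^ p)%:E * \sum_(n <oo) (`|x n| `^ p)%:E)%E.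
  rewrite -nneseriesZl => [|n _]; last exact: t0.
  by apply: eq_eseriesr => n _; rewrite normrZ powRM// EFinM.
have s0 : (0 <= \sum_(n <oo) (`|x n| `^ p)%:E)%E.
  by apply: nneseries_ge0 => n _ _; exact: t0.
rewrite /lp_enorm sZ poweRM ?lee_fin ?powR_ge0//.
by rewrite poweR_EFin -powRrM divff ?gt_eqF// powRr1.
Qed.

Lemma lp_enorm_eq0 (x : forall n, E n) :
  lp_enorm p x = 0%E -> forall n, x n = 0.
Proof.
move=> /poweR_eq0_eq0 x0 n.
have t0 m : (0 <= (`|x m| `^ p)%:E)%E by rewrite lee_fin powR_ge0.
have /x0 s0 : (0 <= \sum_(m <oo) (`|x m| `^ p)%:E)%E.
  by apply: nneseries_ge0 => m _ _.
have : ((`|x n| `^ p)%:E <= \sum_(m <oo) (`|x m| `^ p)%:E)%E.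
  by rewrite (nneseriesD1 (n := n) (P := xpredT) (fun k _ => t0 k))//= leeDl// nneseries_ge0.
rewrite s0 lee_fin => xn.
have /eqP : `|x n| `^ p = 0 by apply/eqP; rewrite eq_le xn powR_ge0.
by rewrite powR_eq0 normr_eq0 => /andP[/eqP].
Qed.

Lemma lp_enorm0 : lp_enorm p (fun n => 0 : E n) = 0%E.
Proof.
have /esym := lp_enormZ 0 (fun n => 0 : E n).
rewrite normr0 mul0e => ->; congr lp_enorm.
by apply: functional_extensionality_dep => n; rewrite scale0r.
Qed.

Fact lp_zero_fin : (lp_enorm p (fun n => 0 : E n)%R < +oo)%E.
Proof. by rewrite lp_enorm0. Qed.

Fact lp_add_fin (x y : L) : (lp_enorm p (fun n => x n + y n)%R < +oo)%E.
Proof.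
by apply: le_lt_trans (lp_enormD _ _) _; rewrite lte_add_pinfty// lp_val_fin.
Qed.

Fact lp_scale_fin (a : R) (x : L) : (lp_enorm p (fun n => a *: x n)%R < +oo)%E.
Proof.
by rewrite lp_enormZ lte_mul_pinfty// ?lee_fin// lp_val_fin.
Qed.

Fact lp_opp_fin (x : L) : (lp_enorm p (fun n => - x n)%R < +oo)%E.
Proof.
have := lp_scale_fin (-1) x; congr (lp_enorm _ _ < _)%E.
by apply: functional_extensionality_dep => n; rewrite scaleN1r.
Qed.

Definition lp_zero : L := LpSum p1 lp_zero_fin.
Definition lp_opp (x : L) : L := LpSum p1 (lp_opp_fin x).
Definition lp_add (x y : L) : L := LpSum p1 (lp_add_fin x y).
Definition lp_scale (a : R) (x : L) : L := LpSum p1 (lp_scale_fin a x).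
Definition lp_norm (x : L) : R := fine (lp_enorm p x).

HB.instance Definition _ := gen_eqMixin L.
HB.instance Definition _ := gen_choiceMixin L.

Fact lp_addA : associative lp_add.
Proof. by move=> x y z; apply: lp_val_inj => n; exact: addrA. Qed.
Fact lp_addC : commutative lp_add.
Proof. by move=> x y; apply: lp_val_inj => n; exact: addrC. Qed.
Fact lp_add0 : left_id lp_zero lp_add.
Proof. by move=> x; apply: lp_val_inj => n; exact: add0r. Qed.
Fact lp_addN : left_inverse lp_zero lp_opp lp_add.
Proof. by move=> x; apply: lp_val_inj => n; exact: addNr. Qed.

HB.instance Definition _ :=
  GRing.isZmodule.Build L lp_addA lp_addC lp_add0 lp_addN.

Fact lp_scaleA a b (x : L) : lp_scale a (lp_scale b x) = lp_scale (a * b) x.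
Proof. by apply: lp_val_inj => n; exact: scalerA. Qed.
Fact lp_scale1 : left_id 1 lp_scale.
Proof. by move=> x; apply: lp_val_inj => n; exact: scale1r. Qed.
Fact lp_scaleDr : right_distributive lp_scale +%R.
Proof. by move=> a x y; apply: lp_val_inj => n; exact: scalerDr. Qed.
Fact lp_scaleDl (x : L) : {morph lp_scale^~ x : a b / a + b}.
Proof. by move=> a b; apply: lp_val_inj => n; exact: scalerDl. Qed.

HB.instance Definition _ := GRing.Zmodule_isLmodule.Build R L
  lp_scaleA lp_scale1 lp_scaleDr lp_scaleDl.

Lemma lp_enorm_fin (x : L) : lp_enorm p x \is a fin_num.
Proof. by rewrite ge0_fin_numE ?lp_enorm_ge0// lp_val_fin. Qed.

Fact lp_normD (x y : L) : lp_norm (x + y) <= lp_norm x + lp_norm y.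
Proof.
rewrite -lee_fin EFinD !fineK ?lp_enorm_fin//; exact: lp_enormD.
Qed.

Fact lp_normZ (a : R) (x : L) : lp_norm (a *: x) = `|a| * lp_norm x.
Proof. by rewrite /lp_norm lp_enormZ fineM// lp_enorm_fin. Qed.

Fact lp_norm_eq0 (x : L) : lp_norm x = 0 -> x = 0.
Proof.
move=> x0; apply: lp_val_inj => n; apply: lp_enorm_eq0.
by rewrite -(fineK (lp_enorm_fin x)); congr EFin.
Qed.

HB.instance Definition _ := Lmodule_isNormed.Build R L
  lp_normD lp_normZ lp_norm_eq0.

End lp_sum_normed.

Record closedSubspace (R : realType) (V : normedModType R) := ClosedSubspace {
  csub :> {pred V};
  csub_submod : submod_closed csub;
  csub_closed : closed [set` csub] }.

HB.instance Definition _ (R : realType) (V : normedModType R)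
    (Y : closedSubspace V) :=
  GRing.isZmodClosed.Build V (csub Y) (GRing.submod_closedB (csub_submod Y)).
HB.instance Definition _ (R : realType) (V : normedModType R)
    (Y : closedSubspace V) :=
  GRing.isScaleClosed.Build R V (csub Y) (GRing.subsemimod_closedZ (csub_submod Y)).

Section subspace.
Context (R : realType) (V : normedModType R) (Y : closedSubspace V).

Definition subspace_of := {x : V | x \in csub Y}.

HB.instance Definition _ := SubChoice.on subspace_of.
HB.instance Definition _ := [SubChoice_isSubLmodule of subspace_of by <:].

Definition subspace_norm (x : subspace_of) : R := `|val x|.

Fact subspace_normD x y :
  subspace_norm (x + y) <= subspace_norm x + subspace_norm y.
Proof. by rewrite /subspace_norm raddfD ler_normD. Qed.
Fact subspace_normZ a x : subspace_norm (a *: x) = `|a| * subspace_norm x.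
Proof. by rewrite /subspace_norm linearZ/= normrZ. Qed.
Fact subspace_norm_eq0 x : subspace_norm x = 0 -> x = 0.
Proof. by move=> /normr0_eq0 x0; apply: val_inj; rewrite x0 raddf0. Qed.

HB.instance Definition _ := Lmodule_isNormed.Build R subspace_of
  subspace_normD subspace_normZ subspace_norm_eq0.

End subspace.

Section quotient.
Context (R : realType) (V : normedModType R) (Y : closedSubspace V).

Definition quotient_by := Quotient.quot (csub Y).

HB.instance Definition _ := GRing.Zmodule.on quotient_by.

Definition quotient_pi (x : V) : quotient_by := \pi_(Quotient.quot (csub Y)) x.

Lemma quotient_piP x y : quotient_pi x = quotient_pi y <-> x - y \in csub Y.
Proof.
by rewrite Quotient.idealrBE; split=> [xy|/eqP//]; apply/eqP.
Qed.

Lemma quotient_piD x y : quotient_pi (x + y) = quotient_pi x + quotient_pi y.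
Proof. exact: raddfD. Qed.

Lemma quotient_pi_surj (q : quotient_by) : exists x, quotient_pi x = q.
Proof. by exists (repr (q : Quotient.quot (csub Y))); exact: reprK. Qed.

Definition quotient_scale (a : R) (q : quotient_by) : quotient_by :=
  quotient_pi (a *: repr (q : Quotient.quot (csub Y))).

Lemma quotient_scale_pi a x :
  quotient_scale a (quotient_pi x) = quotient_pi (a *: x).
Proof.
apply/quotient_piP; rewrite -scalerBr rpredZ//.
by apply/quotient_piP; exact: reprK.
Qed.

Fact quotient_scaleA a b q :
  quotient_scale a (quotient_scale b q) = quotient_scale (a * b) q.
Proof.
by have [x <-] := quotient_pi_surj q; rewrite !quotient_scale_pi scalerA.
Qed.
Fact quotient_scale1 : left_id 1 quotient_scale.
Proof.
by move=> q; have [x <-] := quotient_pi_surj q; rewrite quotient_scale_pi scale1r.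
Qed.
Fact quotient_scaleDr : right_distributive quotient_scale +%R.
Proof.
move=> a q r; have [x <-] := quotient_pi_surj q.
have [y <-] := quotient_pi_surj r.
by rewrite -quotient_piD !quotient_scale_pi scalerDr quotient_piD.
Qed.
Fact quotient_scaleDl q : {morph quotient_scale^~ q : a b / a + b}.
Proof.
move=> a b; have [x <-] := quotient_pi_surj q.
by rewrite !quotient_scale_pi scalerDl quotient_piD.
Qed.

HB.instance Definition _ := GRing.Zmodule_isLmodule.Build R quotient_by
  quotient_scaleA quotient_scale1 quotient_scaleDr quotient_scaleDl.

Definition quotient_norm (q : quotient_by) : R :=
  inf [set `|x| | x in [set x | quotient_pi x = q]].

Lemma quotient_norm_le x : quotient_norm (quotient_pi x) <= `|x|.
Proof.
apply: ge_inf; last by exists x.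
by exists 0 => _ [y _ <-].
Qed.

Lemma quotient_norm_lt q (e : R) : 0 < e ->
  exists2 x, quotient_pi x = q & `|x| < quotient_norm q + e.
Proof.
move=> e0; have [|_ [x xq <-] xe] := @inf_adherent _
  [set `|x| | x in [set x | quotient_pi x = q]] _ e0; last by exists x.
split; last by exists 0 => _ [y _ <-].
by have [x xq] := quotient_pi_surj q; exists `|x|, x.
Qed.

Lemma quotient_norm_ge0 q : 0 <= quotient_norm q.
Proof.
apply: lb_le_inf; last by move=> _ [x _ <-].
by have [x xq] := quotient_pi_surj q; exists `|x|, x.
Qed.

Fact quotient_normD q r :
  quotient_norm (q + r) <= quotient_norm q + quotient_norm r.
Proof.
apply/ler_addgt0Pr => e e0; have e20 : 0 < e / 2 by rewrite divr_gt0.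
have [x <- xe] := quotient_norm_lt q e20.
have [y <- ye] := quotient_norm_lt r e20.
rewrite -quotient_piD (le_trans (quotient_norm_le _))//.
rewrite (le_trans (ler_normD _ _))// (le_trans (lerD (ltW xe) (ltW ye)))//.
by rewrite addrACA -splitr.
Qed.

Let quotient_normZ_le a q : quotient_norm (a *: q) <= `|a| * quotient_norm q.
Proof.
apply/ler_addgt0Pr => e e0.
have a0 : 0 < `|a| + 1 by rewrite ltr_wpDl.
have [x <- xe] := quotient_norm_lt q (divr_gt0 e0 a0).
rewrite [_ *: _]quotient_scale_pi (le_trans (quotient_norm_le _))// normrZ.
rewrite (le_trans (ler_wpM2l (normr_ge0 a) (ltW xe)))// mulrDr lerD2l.
by rewrite mulrCA ger_pMr// ler_pdivrMr// mul1r lerDl.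
Qed.

Fact quotient_normZ a q : quotient_norm (a *: q) = `|a| * quotient_norm q.
Proof.
apply/eqP; rewrite eq_le quotient_normZ_le/=.
have [->|a0] := eqVneq a 0; first by rewrite normr0 mul0r quotient_norm_ge0.
have := quotient_normZ_le a^-1 (a *: q).
rewrite scalerA mulVf// scale1r normfV.
by rewrite ler_pdivlMl// normr_gt0.
Qed.

Fact quotient_norm_eq0 q : quotient_norm q = 0 -> q = 0.
Proof.
have [x <-] := quotient_pi_surj q => q0.
suff xY : x \in csub Y.
  have -> : 0 = quotient_pi 0 by apply/esym; exact: raddf0.
  by apply/quotient_piP; rewrite subr0.
suff : closure [set` csub Y] x by rewrite -(closure_id _).1//; exact: csub_closed.
move=> B /nbhs_ballP[e /= e0 eB].
have [y xy ye] := quotient_norm_lt (quotient_pi x) e0.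
exists (x - y); split; first by apply/quotient_piP.
by apply: eB; rewrite -ball_normE/= opprB addrC subrK -[e]add0r -q0.
Qed.

HB.instance Definition _ := Lmodule_isNormed.Build R quotient_by
  quotient_normD quotient_normZ quotient_norm_eq0.

End quotient.

(* Main.v *)
From HB Require Import structures.
Require Import Defs.
From mathcomp Require Import all_boot all_order all_algebra.
From mathcomp Require Import all_classical all_reals all_analysis.
From mathcomp Require Import ring lra.
Set Implicit Arguments.
Unset Strict Implicit.
Unset Printing Implicit Defensive.
Import Order.TTheory GRing.Theory Num.Theory.
Import numFieldNormedType.Exports.
Local Open Scope classical_set_scope.
Local Open Scope ring_scope.

(* Let [Y] be a closed subspace of [C = l_p(E_n)].  Since bounded sets are
   totally bounded on finitely many coordinates and [p > 1], averaging cut-offs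
   yields scalar sequences [phi_k >= 0], finitely supported and of sum [1],
   such that multiplication by [phi_k] maps [Y] into [Y] up to an error
   [d_k^2 |y|], with [sum_k d_k] small.  Put [N_k(x) = |phi_k^(1/p) x|].  Then
   [sum_k N_k(x)^p = |x|^p], and [|sum_k phi_k x_k|^p <= sum_k N_k(x_k)^p] by
   Jensen.

   Subspaces: choose finitely many [y_(k,i)] in the unit ball of [Y] that are
   dense for [N_k], and [u_(k,i)] in [Y] close to [phi_k y_(k,i)].  The
   normalized [u_(k,i)] define maps [l_1^(r_k) -> Y] whose sum
   [l_p(l_1^(r_k)) -> Y] is almost a metric surjection, because
   [y = sum_k phi_k y].

   Quotients, dually: on [C/Z] let [q_k] be the quotient seminorm of
   [N_k + d_k |.|], and choose finitely many functionals below [q_k] that norm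
   a net of the ball (Hahn-Banach).  They define maps [C/Z -> l_oo^(r_k)] whose
   product [C/Z -> l_p(l_oo^(r_k))] is almost isometric.

   By density, [l_p(l_1^(r_k))] and [l_p(l_oo^(r_k))] are almost isometric to
   almost norm one complemented subspaces of [C], once the [r_k] are increased
   so that the [k]-th block is close to [E_(n_k)] with [n_k] increasing. *)

(** * Norm estimates and completeness in l_p-sums *)

Section lp_basics.
Context (R : realType) (p : R) (p1 : 1 <= p).

Let p0 : 0 < p. Proof. exact: lt_le_trans p1. Qed.

Lemma powR_le2 (x y : R) : 0 <= x -> 0 <= y -> (x `^ p <= y `^ p) = (x <= y).
Proof.
move=> x0 y0; apply/idP/idP; last by move=> xy; apply: ge0_ler_powR; rewrite ?nnegrE// ltW.
apply: contraLR; rewrite -!ltNge => yx.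
by apply: gt0_ltr_powR; rewrite ?nnegrE.
Qed.

Lemma powR_root (x : R) : 0 <= x -> (x `^ p^-1) `^ p = x.
Proof. by move=> x0; rewrite -powRrM mulVf ?gt_eqF// powRr1. Qed.

Context (E : nat -> normedModType R).
Local Notation L := (lp_sum E p1).

Let term_ge0 (x : forall n, E n) n : (0 <= (`|x n| `^ p)%:E)%E.
Proof. by rewrite lee_fin powR_ge0. Qed.

Lemma lp_norm_series (x : L) :
  (\sum_(n <oo) (`|x n| `^ p)%:E)%E = (`|x| `^ p)%:E.
Proof.
have -> : `|x| = lp_norm x by [].
rewrite /lp_norm; have := lp_val_fin x; rewrite /lp_enorm.
have : (0 <= \sum_(n <oo) (`|x n| `^ p)%:E)%E by apply: nneseries_ge0 => *.
case: (\sum_(n <oo) _)%E => [s||]//; last by rewrite poweRyr ?gt_eqF ?invr_gt0.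
by rewrite lee_fin => s0 _; rewrite poweR_EFin/= powR_root.
Qed.

Lemma lp_norm_sum_le (x : L) n :
  \sum_(0 <= i < n) `|x i| `^ p <= `|x| `^ p.
Proof.
rewrite -lee_fin -lp_norm_series -sumEFin.
by apply: nneseries_lim_ge => k _ _; exact: term_ge0.
Qed.

Lemma lp_enorm_le_sum (x : forall n, E n) (M : R) : 0 <= M ->
  (forall n, \sum_(0 <= i < n) `|x i| `^ p <= M `^ p) ->
  (lp_enorm p x <= M%:E)%E.
Proof.
move=> M0 xM.
have sM : (\sum_(n <oo) (`|x n| `^ p)%:E <= (M `^ p)%:E)%E.
  apply: lime_le; first by apply: is_cvg_nneseries => k _ _; exact: term_ge0.
  by apply: nearW => n; rewrite sumEFin lee_fin.
have : (0 <= \sum_(n <oo) (`|x n| `^ p)%:E)%E by apply: nneseries_ge0 => *.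
rewrite /lp_enorm; case: (\sum_(n <oo) _)%E sM => [s||]//.
rewrite lee_fin => sM; rewrite lee_fin => s0.
by rewrite poweR_EFin lee_fin -powR_le2 ?powR_ge0// powR_root.
Qed.

Lemma lp_norm_le (x : L) (M : R) : 0 <= M ->
  (forall n, \sum_(0 <= i < n) `|x i| `^ p <= M `^ p) -> `|x| <= M.
Proof.
move=> M0 xM; rewrite -lee_fin.
have -> : `|x| = lp_norm x by [].
by rewrite /lp_norm fineK ?lp_enorm_fin// lp_enorm_le_sum.
Qed.

Lemma lp_exists (x : forall n, E n) (M : R) : 0 <= M ->
  (forall n, \sum_(0 <= i < n) `|x i| `^ p <= M `^ p) ->
  {y : L | (forall n, y n = x n) & `|y| <= M}.
Proof.
move=> M0 xM.
have xf : (lp_enorm p x < +oo)%E.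
  by apply: le_lt_trans (lp_enorm_le_sum M0 xM) _; rewrite ltry.
by exists (LpSum p1 xf) => //; exact: lp_norm_le.
Qed.

Lemma lp_coord_le (x : L) n : `|x n| <= `|x|.
Proof.
rewrite -powR_le2//; apply: le_trans (lp_norm_sum_le x n.+1).
by rewrite big_nat_recr//= lerDr sumr_ge0// => i _; exact: powR_ge0.
Qed.

Lemma lp_valD (x y : L) n : (x + y) n = x n + y n. Proof. by []. Qed.
Lemma lp_valB (x y : L) n : (x - y) n = x n - y n. Proof. by []. Qed.
Lemma lp_valZ a (x : L) n : (a *: x) n = a *: x n. Proof. by []. Qed.
Lemma lp_val_sum I (r : seq I) (P : pred I) (F : I -> L) n :
  (\sum_(i <- r | P i) F i) n = \sum_(i <- r | P i) F i n.
Proof. by elim/big_rec2: _ => // i u v _ <-. Qed.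

End lp_basics.

Section lp_domination.
Context (R : realType) (p : R) (p1 : 1 <= p).
Context (E F : nat -> normedModType R).

Lemma lp_norm_dom (x : lp_sum E p1) (y : lp_sum F p1) :
  (forall n, `|x n| <= `|y n|) -> `|x| <= `|y|.
Proof.
move=> xy; apply: lp_norm_le => // n; apply: le_trans (lp_norm_sum_le y n).
by apply: ler_sum => i _; rewrite powR_le2.
Qed.

(** The majorant [y] may come from another family. Later it is often a scalar sequence, with [F]
    constantly [R^o], so that block estimates reduce to the triangle inequality for scalar
    sequences. *)
Lemma lp_exists_dom (x : forall n, E n) (y : lp_sum F p1) :
  (forall n, `|x n| <= `|y n|) ->
  {z : lp_sum E p1 | (forall n, z n = x n) & `|z| <= `|y|}.
Proof.
move=> xy; apply: lp_exists => // n; apply: le_trans (lp_norm_sum_le y n).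
by apply: ler_sum => i _; rewrite powR_le2.
Qed.
End lp_domination.


(** * Truncation to finitely many coordinates *)

Section lp_trunc.
Context (R : realType) (p : R) (p1 : 1 <= p).
Context (E : nat -> normedModType R).
Local Notation L := (lp_sum E p1).

Let p0 : 0 < p. Proof. exact: lt_le_trans p1. Qed.

Definition seq_trunc n (x : forall i, E i) : forall i, E i :=
  fun i => if (i < n)%N then x i else 0.

Lemma seq_trunc_sum n (x : forall i, E i) m :
  \sum_(0 <= i < m) `|seq_trunc n x i| `^ p <=
  \sum_(0 <= i < n) `|x i| `^ p.
Proof.
have [nm|/ltnW mn] := leqP n m.
  rewrite (big_cat_nat (leq0n _) nm)/= [X in _ + X]big_nat [X in _ + X]big1 ?addr0; last first.
    move=> i /andP[ni _]; rewrite /seq_trunc ltnNge ni/= normr0 powR0//.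
    by rewrite gt_eqF.
  rewrite !big_nat; apply: ler_sum => i /andP[_ ni].
  by rewrite /seq_trunc ni.
rewrite [leRHS](big_cat_nat (leq0n _) mn)/=.
apply: ler_wpDr; first by apply: sumr_ge0 => i _; exact: powR_ge0.
rewrite !big_nat; apply: ler_sum => i /andP[_ im].
by rewrite /seq_trunc (leq_trans im mn).
Qed.

Lemma seq_trunc_fin n (x : forall i, E i) :
  (lp_enorm p (seq_trunc n x) < +oo)%E.
Proof.
have s0 : 0 <= \sum_(0 <= i < n) `|x i| `^ p.
  by apply: sumr_ge0 => i _; exact: powR_ge0.
apply: (@le_lt_trans _ _ ((\sum_(0 <= i < n) `|x i| `^ p) `^ p^-1)%:E).
  apply: (lp_enorm_le_sum p1); first exact: powR_ge0.
  by move=> m; rewrite (powR_root p1)// seq_trunc_sum.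
by rewrite ltry.
Qed.

(** Truncation is defined on arbitrary families, summable or not: the completeness proof truncates
    [x - l] before it is known to lie in the sum. *)
Definition lp_trunc n (x : forall i, E i) : L := LpSum p1 (seq_trunc_fin n x).

Lemma lp_truncE n (x : forall i, E i) i :
  lp_trunc n x i = if (i < n)%N then x i else 0.
Proof. by []. Qed.

Lemma lp_trunc_norm n (x : forall i, E i) :
  `|lp_trunc n x| `^ p = \sum_(0 <= i < n) `|x i| `^ p.
Proof.
apply/eqP; rewrite eq_le; apply/andP; split; last first.
  apply: le_trans (lp_norm_sum_le _ n); rewrite !big_nat.
  by apply: ler_sum => i /andP[_ ni]; rewrite lp_truncE ni.
have s0 : 0 <= \sum_(0 <= i < n) `|x i| `^ p.
  by apply: sumr_ge0 => i _; exact: powR_ge0.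
rewrite -[leRHS](powR_root p1)// powR_le2 ?powR_ge0//; apply: lp_norm_le => [|m]; first exact: powR_ge0.
by rewrite (powR_root p1)//; exact: seq_trunc_sum.
Qed.

Lemma lp_trunc_le n (x : L) : `|lp_trunc n x| <= `|x|.
Proof.
apply: lp_norm_dom => i; rewrite lp_truncE; case: ifP => // _.
by rewrite normr0.
Qed.

Lemma lp_trunc_small n (x : forall i, E i) (e : R) : 0 <= e ->
  (forall i, (i < n)%N -> `|x i| <= e) -> `|lp_trunc n x| <= n%:R * e.
Proof.
move=> e0 xe; rewrite -(powR_le2 p1) ?mulr_ge0// lp_trunc_norm powRM//.
apply: (@le_trans _ _ (\sum_(0 <= i < n) e `^ p)).
  rewrite !big_nat; apply: ler_sum => i /andP[_ ni].
  by rewrite powR_le2// xe.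
rewrite big_const_nat iter_addr_0 subn0 -[leLHS]mulr_natl ler_wpM2r ?powR_ge0//.
case: n {xe} => [|n]; first by rewrite powR_ge0.
by rewrite le1r_powR// ler1n.
Qed.

(** The [p]-th power of the tail norm is at most [|x|^p - S n], and the partial sums [S n] have
    supremum [|x|^p]. *)
Lemma lp_trunc_cvg (x : L) (e : R) : 0 < e ->
  exists n0, forall n, (n0 <= n)%N -> `|x - lp_trunc n x| <= e.
Proof.
move=> e0; have ep0 : 0 < e `^ p by rewrite powR_gt0.
pose S n := \sum_(0 <= i < n) `|x i| `^ p.
have [n0 n0P] : exists n0, `|x| `^ p - e `^ p < S n0.
  apply: contrapT => /forallNP H.
  (* Suppose all [S n] are at most [|x|^p - e^p]. If this number is positive, its root bounds [|x|],
     which is absurd; otherwise every [S n] vanishes, so [x = 0], and [S 0] already exceeds it. *)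
  have [ex|xe] := lerP (`|x| `^ p) (e `^ p); last first.
    have : `|x| <= (`|x| `^ p - e `^ p) `^ p^-1.
      apply: lp_norm_le; first exact: powR_ge0.
      move=> n; rewrite (powR_root p1) ?subr_ge0 ?(ltW xe)//.
      by have /negP := H n; rewrite -leNgt.
    rewrite -(powR_le2 p1) ?powR_ge0// (powR_root p1) ?subr_ge0 ?(ltW xe)//.
    by rewrite lerDl oppr_ge0 leNgt ep0.
  have H0 n : S n = 0.
    have /negP := H n; rewrite -leNgt => Sn; apply/eqP; rewrite eq_le.
    rewrite sumr_ge0 ?andbT; last by move=> i _; exact: powR_ge0.
    by apply: le_trans Sn _; rewrite subr_le0.
  have x0 : `|x| <= 0.
    by apply: lp_norm_le => // n; rewrite [leLHS]H0 powR_ge0.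
  apply: (H 0%N); rewrite H0 (_ : `|x| = 0).
    by rewrite powR0 ?gt_eqF// sub0r oppr_lt0.
  by apply/eqP; rewrite eq_le x0 normr_ge0.
exists n0 => n n0n; apply: lp_norm_le => [|m]; first exact: ltW.
have [mn|/ltnW nm] := leqP m n.
  rewrite big_nat big1 ?powR_ge0// => i /andP[_ im].
  rewrite lp_valB lp_truncE (leq_trans im mn) subrr normr0 powR0//.
  by rewrite gt_eqF.
have -> : \sum_(0 <= i < m) `|(x - lp_trunc n x) i| `^ p = S m - S n.
  rewrite /S (big_cat_nat (leq0n _) nm)/= [X in _ = X - _](big_cat_nat (leq0n _) nm)/=.
  rewrite [X in X + _ = _]big_nat [X in X + _ = _]big1 ?add0r; last first.
    move=> i /andP[_ im].
    by rewrite /seq_trunc im subrr normr0 powR0// gt_eqF.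
  rewrite addrAC subrr add0r !big_nat; apply: eq_bigr => i /andP[ni _].
  by rewrite /seq_trunc ltnNge ni subr0.
have Sm : S m <= `|x| `^ p by exact: lp_norm_sum_le.
have Sn : S n0 <= S n.
  rewrite /S [leRHS](big_cat_nat (leq0n _) n0n)/= lerDl.
  by apply: sumr_ge0 => i _; exact: powR_ge0.
by lra.
Qed.

End lp_trunc.

Section lp_complete.
Context (R : realType) (p : R) (p1 : 1 <= p) (E : nat -> completeNormedModType R).
Local Notation L := (lp_sum E p1).

(** [l] is the coordinatewise limit. If the ball of radius [e] at [x] belongs to [F], the
    truncations of [x - l] have norm at most [e]: pass through a [y] of that ball close to [l] on
    the first [n] coordinates. *)
Lemma lp_cauchy_cvg (F : set_system L) : ProperFilter F -> cauchy F -> cvg F.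
Proof.
move=> FF /cauchyP Fc.
have Fcoord n : cauchy ((fun x : L => x n) @ F).
  apply/cauchyP => e e0; have [x Fx] := Fc e e0; exists (x n).
  suff : F [set y : L | ball (x n) e (y n)] by [].
  apply: filterS Fx => y; rewrite -!ball_normE/=; apply: le_lt_trans.
  exact: (lp_coord_le (x - y) n).
pose l n : E n := lim ((fun x : L => x n) @ F).
have lP n : (fun x : L => x n) @ F --> l n by apply: cauchy_cvg; exact: Fcoord.
have key (x : L) (e : R) : 0 < e -> F (ball x e) -> forall n,
    \sum_(0 <= i < n) `|x i - l i| `^ p <= e `^ p.
  move=> e0 Fx n; rewrite -(lp_trunc_norm p1 n (fun i => x i - l i)).
  rewrite powR_le2 ?(ltW e0)//; apply/ler_addgt0Pr => h h0.
  have h'0 : 0 < h / n.+1%:R by rewrite divr_gt0.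
  have Fl : F [set y : L | forall i, (i < n)%N -> `|l i - y i| < h / n.+1%:R].
    elim: n {h0} (h / n.+1%:R) h'0 => [|n IH] d d0; first exact: filterS filterT.
    have /cvgrPdist_lt/(_ _ d0) Fn := lP n.
    apply: filterS2 (IH _ d0) Fn => y yn ynn i.
    by rewrite ltnS leq_eqVlt => /orP[/eqP->//|]; exact: yn.
  near F => y.
  have -> : lp_trunc p1 n (fun i => x i - l i) =
      lp_trunc p1 n (x - y) + lp_trunc p1 n (fun i => y i - l i).
    apply: lp_val_inj => i; rewrite lp_valD !lp_truncE.
    by case: ifP => _; rewrite ?addr0// lp_valB addrA subrK.
  apply: le_trans (ler_normD _ _) _; apply: lerD.
    apply: le_trans (lp_trunc_le _ _) _; apply/ltW.
    by have : ball x e y by [near: y]; rewrite -ball_normE.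
  apply: (@le_trans _ _ (n%:R * (h / n.+1%:R))).
    apply: lp_trunc_small; first exact: ltW.
    by move=> i ni; rewrite distrC ltW//; move: i ni; near: y.
  by rewrite mulrCA ger_pMr// ler_pdivrMr// mul1r ler_nat.
(* It is [x0 - l] that is first seen to lie in the sum, as [z]; the limit is then recovered as
   [x0 - z]. *)
have [x0 Fx0] := Fc 1 ltr01.
have [z zE _] := lp_exists p1 ler01 (key _ _ ltr01 Fx0).
apply/cvg_ex; exists (x0 - z); apply/cvgrPdist_le => e e0.
have e20 : 0 < e / 2 by rewrite divr_gt0.
have [x Fx] := Fc _ e20.
have xl : `|x - (x0 - z)| <= e / 2.
  apply: lp_norm_le => [|n]; first exact: ltW.
  rewrite (le_trans _ (key _ _ e20 Fx n))// ler_sum// => i _.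
  by rewrite !lp_valB zE subKr.
apply: filterS Fx => y; rewrite -ball_normE/= => xy.
have -> : x0 - z - y = (x - y) - (x - (x0 - z)).
  by rewrite opprB [RHS]addrC addrA subrK.
by rewrite (splitr e) (le_trans (ler_normB _ _))// lerD// ltW.
Unshelve. all: by end_near. Qed.

HB.instance Definition _ := Uniform_isComplete.Build L lp_cauchy_cvg.

End lp_complete.

(** * Hahn-Banach for sublinear functionals *)

Section hahn_banach.
Context (R : realType) (V : lmodType R).
Implicit Types (q g : V -> R) (x y z : V).

Definition sublinear q := (forall x y, q (x + y) <= q x + q y) /\
  (forall t x, 0 <= t -> q (t *: x) <= t * q x).

Lemma sublinear0 q : sublinear q -> q 0 = 0.
Proof.
move=> [qD qZ]; have := qD 0 0; have := qZ 0 0 (lexx _).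
by rewrite addr0 scaler0 mul0r; lra.
Qed.

Lemma sublinearZ q t x : sublinear q -> 0 <= t -> q (t *: x) = t * q x.
Proof.
move=> qs; rewrite le_eqVlt => /predU1P[<-|t0].
  by rewrite scale0r mul0r sublinear0.
apply/eqP; rewrite eq_le (qs.2 _ _ (ltW t0))/= -ler_pdivlMl//.
by have := qs.2 t^-1 (t *: x); rewrite scalerK ?gt_eqF// invr_ge0; apply; exact: ltW.
Qed.

Lemma sublinear_geN q x : sublinear q -> - q (- x) <= q x.
Proof.
move=> qs; have := qs.1 x (- x); rewrite subrr sublinear0//; lra.
Qed.

(** The infimum of this set is the auxiliary functional of the classical Hahn-Banach argument: a
    sublinear minorant of [q] with value at most [- q z] at [- z], so that a linear functional below
    it is at least [q z] at [z]. *)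
Definition shift_set q z x : set R :=
  [set q (x + t *: z) - t * q z | t in [set t | 0 <= t]].

Definition sublinear_shift q z x : R := inf (shift_set q z x).

Lemma shift_set_lb q z x : sublinear q -> has_lbound (shift_set q z x).
Proof.
move=> qs; exists (- q (- x)) => _ [t /= t0 <-].
have := qs.1 (x + t *: z) (- x); rewrite addrAC subrr add0r sublinearZ//; lra.
Qed.

Lemma sublinear_shift_le q z x t : sublinear q -> 0 <= t ->
  sublinear_shift q z x <= q (x + t *: z) - t * q z.
Proof. by move=> qs t0; apply: ge_inf; [exact: shift_set_lb|exists t]. Qed.

Lemma sublinear_shift_ge q z x (m : R) :
  (forall t, 0 <= t -> m <= q (x + t *: z) - t * q z) ->
  m <= sublinear_shift q z x.
Proof.
move=> mq; apply: lb_le_inf; last by move=> _ [t /= t0 <-]; exact: mq.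
by exists (q (x + 0 *: z) - 0 * q z), 0 => /=.
Qed.

Lemma sublinear_shiftP q z : sublinear q ->
  [/\ sublinear (sublinear_shift q z), forall x, sublinear_shift q z x <= q x
    & sublinear_shift q z (- z) <= - q z].
Proof.
move=> qs; split.
- split=> [x y|c x c0].
    rewrite -lerBlDr; apply: sublinear_shift_ge => t t0.
    rewrite lerBlDr -lerBlDl; apply: sublinear_shift_ge => s s0.
    rewrite lerBlDl; apply: le_trans (sublinear_shift_le _ _ qs (addr_ge0 t0 s0)) _.
    have := qs.1 (x + t *: z) (y + s *: z).
    by rewrite addrACA -scalerDl; lra.
  have H s : 0 <= s -> sublinear_shift q z (c *: x) <=
      c * (q (x + s *: z) - s * q z).
    move=> s0; apply: le_trans (sublinear_shift_le _ _ qs (mulr_ge0 c0 s0)) _.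
    by rewrite -scalerA -scalerDr mulrBr mulrA lerB// qs.2.
  move: c0; rewrite le_eqVlt => /predU1P[c0|c0].
    by have := H 0 (lexx _); rewrite -c0 !mul0r.
  rewrite -ler_pdivrMl//; apply: sublinear_shift_ge => s s0.
  by rewrite ler_pdivrMl// H.
- move=> x; apply: le_trans (sublinear_shift_le _ _ qs (lexx 0)) _.
  by rewrite scale0r addr0 mul0r subr0.
- apply: le_trans (sublinear_shift_le _ _ qs ler01) _.
  by rewrite scale1r addNr sublinear0// sub0r mul1r.
Qed.

(** Zorn's lemma on the sublinear minorants of [q]. A nonempty chain is bounded below by its
    pointwise infimum, which is finite because every minorant satisfies [f x >= - q (- x)]. *)
Lemma minimal_sublinear q : sublinear q ->
  exists g, [/\ sublinear g, forall x, g x <= q x &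
    forall h, sublinear h -> (forall x, h x <= g x) -> h = g].
Proof.
move=> qs.
pose T := {g | sublinear g /\ forall x, g x <= q x}.
(* The order is reversed, so that a maximal element for [r] is a minimal functional. *)
pose r (f g : T) := `[< forall x, sval g x <= sval f x >].
have [|f g h|f g|A Atot|[g [gs gq]] gmin] := @Zorn T r.
- by move=> f; apply/asboolP.
- move=> /asboolP fg /asboolP gh; apply/asboolP => x.
  exact: le_trans (gh x) (fg x).
- case: f g => [f fP] [g gP] /asboolP fg /asboolP gf; apply: eq_exist.
  by apply/funext => x; apply/eqP; rewrite eq_le gf fg.
- have [[f0 Af0]|A0] := pselect (exists f, A f); last first.
    by exists (exist _ q (conj qs (fun x => lexx _))) => s As; case: A0; exists s.
  pose B x := [set sval f x | f in A].
  have Blb x : has_lbound (B x).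
    exists (- q (- x)) => _ [[f [fs fq]] _ <-] /=.
    by have := sublinear_geN x fs; have := fq (- x); lra.
  pose g x := inf (B x).
  have gle f x : A f -> g x <= sval f x by move=> Af; apply: ge_inf => //; exists f.
  have gge x m : (forall f, A f -> m <= sval f x) -> m <= g x.
    move=> mf; apply: lb_le_inf; first by exists (sval f0 x), f0.
    by move=> _ [f Af <-]; exact: mf.
  have gs : sublinear g.
    split=> [x y|c x c0].
      rewrite -lerBlDr; apply: (gge) => f Af; rewrite lerBlDr -lerBlDl.
      apply: (gge) => h Ah; rewrite lerBlDl.
      (* Subadditivity is applied to the smaller of the two members of the chain. *)
      have [/asboolP fh|/asboolP hf] := Atot f h Af Ah.
        apply: le_trans (gle _ _ Ah) _; apply: le_trans ((svalP h).1.1 _ _) _.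
        exact: lerD.
      apply: le_trans (gle _ _ Af) _; apply: le_trans ((svalP f).1.1 _ _) _.
      by apply: lerD.
    have H f : A f -> g (c *: x) <= c * sval f x.
      by move=> Af; apply: le_trans (gle _ _ Af) _; exact: (svalP f).1.2.
    move: c0; rewrite le_eqVlt => /predU1P[c0|c0].
      by have := H f0 Af0; rewrite -c0 !mul0r.
    by rewrite -ler_pdivrMl//; apply: (gge) => f Af; rewrite ler_pdivrMl// H.
  have gq x : g x <= q x by apply: le_trans (gle _ _ Af0) _; exact: (svalP f0).2.
  by exists (exist _ g (conj gs gq)) => s As; apply/asboolP => x; exact: gle.
exists g; split=> // h hs hg.
have hq x : h x <= q x by exact: le_trans (hg x) (gq x).
have := gmin (exist _ h (conj hs hq)).
by move=> H; have /(congr1 sval) := H (introT (asboolP _) hg).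
Qed.

(* A minimal sublinear [g] is linear: [sublinear_shift g y <= g] must be an
   equality, hence [g (- y) <= - g y]. *)
Lemma hahn_banach_sublinear q z : sublinear q ->
  exists f : V -> R, [/\ forall a x y, f (a *: x + y) = a * f x + f y,
    forall x, f x <= q x & f z = q z].
Proof.
move=> qs; have [q's q'q q'z] := sublinear_shiftP z qs.
have [g [gs gq' gmin]] := minimal_sublinear q's.
have gN y : g (- y) = - g y.
  have [hs hg hy] := sublinear_shiftP y gs; rewrite (gmin _ hs hg) in hy.
  by have := sublinear_geN y gs; lra.
have gD x y : g (x + y) = g x + g y.
  have := gs.1 x y; have := gs.1 (x + y) (- y); rewrite addrK gN; lra.
have gZ a x : g (a *: x) = a * g x.
  have [a0|a0] := lerP 0 a; first exact: sublinearZ.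
  rewrite -[in LHS](opprK a) scaleNr gN sublinearZ ?oppr_ge0 ?ltW//.
  by rewrite mulNr opprK.
exists g; split=> [a x y|x|]; first by rewrite gD gZ.
  exact: le_trans (gq' x) (q'q x).
apply/eqP; rewrite eq_le (le_trans (gq' z) (q'q z))/=.
by have := gq' (- z); rewrite gN; lra.
Qed.

End hahn_banach.

(** * Finite-dimensional spaces *)

Section findim.
Context (R : realType).

Lemma mx_coord_le n (c : 'rV[R]_n) i : `|c ord0 i| <= `|c|.
Proof.
rewrite [leRHS]mx_normrE.
by apply: (le_bigmax _ (fun ij : 'I_1 * 'I_n => `|c ij.1 ij.2|) (ord0, i)).
Qed.

Lemma mx_norm_le n (c : 'rV[R]_n) (M : R) : 0 <= M ->
  (forall i, `|c ord0 i| <= M) -> `|c| <= M.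
Proof.
move=> M0 cM; rewrite [leLHS]mx_normrE.
by apply: bigmax_le => // -[i j] _ /=; rewrite ord1.
Qed.

Context (V : normedModType R).

Definition lincomb n (b : 'I_n -> V) (c : 'rV[R]_n) : V :=
  \sum_(i < n) c ord0 i *: b i.

Lemma lincombB n (b : 'I_n -> V) c d :
  lincomb b (c - d) = lincomb b c - lincomb b d.
Proof.
by rewrite /lincomb -sumrB; apply: eq_bigr => i _; rewrite !mxE scalerBl.
Qed.

Lemma lincombZ n (b : 'I_n -> V) a c : lincomb b (a *: c) = a *: lincomb b c.
Proof.
by rewrite /lincomb scaler_sumr; apply: eq_bigr => i _; rewrite !mxE scalerA.
Qed.

Lemma lincomb_norm_le n (b : 'I_n -> V) c :
  `|lincomb b c| <= (\sum_(i < n) `|b i|) * `|c|.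
Proof.
rewrite /lincomb mulr_suml (le_trans (ler_norm_sum _ _ _))// ler_sum// => i _.
by rewrite normrZ mulrC ler_wpM2l// mx_coord_le.
Qed.

(** A spanning family of least length is free: a relation with a nonzero coefficient at [j] would
    allow the [j]-th vector to be dropped. *)
Lemma findim_basis : finite_dimensional V ->
  exists n (b : 'I_n -> V), (forall v, exists c, v = lincomb b c) /\
    (forall c, lincomb b c = 0 -> c = 0).
Proof.
move=> [m [b0 b0P]].
have ex : exists n, `[< exists b : 'I_n -> V, forall v, exists c, v = lincomb b c >].
  exists m; apply/asboolP; exists b0 => v; have [c ->] := b0P v.
  exists (\row_i c i).
  by rewrite /lincomb; apply: eq_bigr => i _; rewrite mxE.
case: (ex_minnP ex) => n /asboolP[b bP] nmin; exists n, b; split=> // c c0.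
apply/rowP => j; rewrite mxE; apply/eqP; apply: contraT => cj.
case: n b bP nmin c c0 j cj => [|n] b bP nmin c c0 j cj; first by case: j cj.
have /nmin : `[< exists b : 'I_n -> V, forall v, exists c, v = lincomb b c >].
  apply/asboolP; exists (fun i => b (lift j i)) => v.
  have [d ->] := bP v.
  pose e := d - (d ord0 j / c ord0 j) *: c.
  exists (\row_i e ord0 (lift j i)).
  have -> : lincomb b d = lincomb b e by rewrite lincombB lincombZ c0 scaler0 subr0.
  rewrite /lincomb (bigD1_ord j)//= [e ord0 j]mxE !mxE divfK// subrr scale0r add0r.
  by apply: eq_bigr => i _; rewrite [in RHS]mxE.
by rewrite ltnn.
Qed.

(** The norm of the combination attains its minimum on the compact unit sphere of coefficients, and
    freeness makes it positive. With no coefficients the sphere is empty, hence the separate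
    case. *)
Lemma lincomb_norm_ge n (b : 'I_n -> V) : (forall c, lincomb b c = 0 -> c = 0) ->
  exists2 mu : R, 0 < mu & forall c, mu * `|c| <= `|lincomb b c|.
Proof.
case: n b => [|n] b binj.
  by exists 1 => // c; rewrite (thinmx0 c) normr0 mulr0.
pose K := \sum_(i < n.+1) `|b i|.
have K0 : 0 < K + 1 by rewrite ltr_wpDl// sumr_ge0.
have fc : continuous (fun c : 'rV[R]_n.+1 => `|lincomb b c|).
  move=> c; apply/(@cvgrPdist_lt _ _ _ (nbhs c)) => e e0.
  have ek : 0 < e / (K + 1) by rewrite divr_gt0.
  near=> d.
  have cd : `|c - d| < e / (K + 1) by near: d; apply: cvgr_dist_lt.
  rewrite (le_lt_trans (ler_dist_dist _ _))// -lincombB.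
  rewrite (le_lt_trans (lincomb_norm_le _ _))//.
  rewrite ltr_pdivlMr// in cd; apply: le_lt_trans cd.
  by rewrite [leRHS]mulrC ler_wpM2r// lerDl.
pose A : set 'rV[R]_n.+1 := [set c | `|c| = 1].
have A1 : A (const_mx 1).
  rewrite /A/=; apply/eqP; rewrite eq_le; apply/andP; split.
    by apply: mx_norm_le => // i; rewrite mxE normr1.
  by have := mx_coord_le (const_mx 1 : 'rV[R]_n.+1) ord0; rewrite mxE normr1.
have Ac : compact A.
  apply: bounded_closed_compact.
    exists 1; split=> // x x1 c /= ->; exact: ltW.
  have -> : A = (fun c : 'rV[R]_n.+1 => `|c|) @^-1` [set 1] by [].
  apply: closed_comp => [c _|]; [exact: norm_continuous|exact: closed_eq].
have [c cA cmin] := EVT_min_rV (ex_intro _ _ A1) Ac (continuous_subspaceT fc).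
have c1 : `|c| = 1 by move: cA; rewrite inE.
exists `|lincomb b c| => [|d].
  rewrite normr_gt0; apply/eqP => /binj c0.
  by move: c1; rewrite c0 normr0 => /eqP; rewrite eq_sym oner_eq0.
have [->|d0] := eqVneq d 0; first by rewrite normr0 mulr0.
rewrite -ler_pdivlMr ?normr_gt0//.
have := cmin (`|d|^-1 *: d); rewrite lincombZ normrZ normfV normr_id mulrC; apply.
by rewrite inE /A/= normrZ normfV normr_id mulVf// normr_eq0.
Unshelve. all: by end_near. Qed.

(* Total boundedness of bounded sets, as a colouring by a finite type whose
   classes have small diameter: unlike nets, colourings pull back along maps
   and combine by pairing. *)
Lemma findim_coloring (M e : R) : finite_dimensional V -> 0 < e ->
  exists (I : finType) (c : V -> I), forall x y : V,
    `|x| <= M -> `|y| <= M -> c x = c y -> `|x - y| <= e.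
Proof.
move=> /findim_basis[n [b [bspan binj]]] e0.
have [mu mu0 muP] := lincomb_norm_ge binj.
have /choice[co coP] := bspan.
pose K := \sum_(i < n) `|b i|.
have K0 : 0 < K + 1 by rewrite ltr_wpDl// sumr_ge0.
(* The colour of [x] records the cell of each coefficient in a grid of mesh [h]. On the ball the
   coefficients have modulus at most [B]; adding [B] makes them nonnegative before [truncn]. *)
pose h := e / (K + 1); have h0 : 0 < h by rewrite divr_gt0.
pose B := M / mu.
have coB x i : `|x| <= M -> `|co x ord0 i| <= B.
  move=> xM; apply: le_trans (mx_coord_le _ _) _.
  by rewrite /B ler_pdivlMr// mulrC (le_trans (muP _))// -coP.
pose N := Num.truncn ((B + B) / h).
pose d x i := Num.truncn ((co x ord0 i + B) / h).
exists {ffun 'I_n -> 'I_N.+1}, (fun x => [ffun i => inord (d x i)]).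
move=> x y xM yM /ffunP xy.
have dE x' i : `|x'| <= M -> (d x' i <= N)%N /\ 
    (d x' i)%:R * h <= co x' ord0 i + B < (d x' i).+1%:R * h.
  move=> /(coB _ i); rewrite ler_norml => /andP[l u]; split.
    rewrite /d /N; apply: le_truncn; rewrite ler_pM2r ?invr_gt0//; lra.
  rewrite -ler_pdivlMr// -ltr_pdivrMr//; apply: truncn_itv.
  by rewrite divr_ge0// ?(ltW h0)//; lra.
rewrite (coP x) (coP y) -lincombB (le_trans (lincomb_norm_le _ _))//.
apply: (@le_trans _ _ (K * h)); last first.
  by rewrite /h mulrCA ger_pMr// ler_pdivrMr// mul1r lerDl.
rewrite ler_wpM2l ?sumr_ge0//; apply: mx_norm_le; first exact: ltW.
move=> i; rewrite !mxE.
have [dx /andP[x1 x2]] := dE x i xM; have [dy /andP[y1 y2]] := dE y i yM.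
have := congr1 val (xy i); rewrite !ffunE /= !inordK// => dxy.
rewrite dxy in x1 x2; rewrite ler_norml; rewrite -natr1 mulrDl mul1r in x2 y2; lra.
Qed.

End findim.

HB.instance Definition _ (R : realType) n := Complete.on 'rV[R]_n.

Section l1.
Context (R : realType) (n : nat).

(** A fresh name with the algebra of row vectors but not their norm: plain row vectors carry the
    maximum norm and serve as [l_oo] in the quotient case. *)
Definition l1 : Type := 'rV[R]_n.

HB.instance Definition _ := GRing.Lmodule.copy l1 'rV[R]_n.

Definition l1_norm (c : l1) : R := \sum_(i < n) `|(c : 'rV[R]_n) ord0 i|.

Fact l1_normD (x y : l1) : l1_norm (x + y) <= l1_norm x + l1_norm y.
Proof.
rewrite /l1_norm -big_split/=; apply: ler_sum => i _.
by rewrite mxE ler_normD.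
Qed.

Fact l1_normZ (a : R) (x : l1) : l1_norm (a *: x) = `|a| * l1_norm x.
Proof.
by rewrite /l1_norm mulr_sumr; apply: eq_bigr => i _; rewrite mxE normrM.
Qed.

Fact l1_norm_eq0 (x : l1) : l1_norm x = 0 -> x = 0.
Proof.
move=> /eqP; rewrite psumr_eq0// => /allP x0.
apply/rowP => i; rewrite mxE; apply/eqP; rewrite -normr_eq0.
by have := x0 i; rewrite mem_index_enum => /(_ isT).
Qed.

HB.instance Definition _ := Lmodule_isNormed.Build R l1
  l1_normD l1_normZ l1_norm_eq0.

Lemma l1_normE (c : l1) : `|c| = \sum_(i < n) `|(c : 'rV[R]_n) ord0 i|.
Proof. by []. Qed.

Lemma l1_coord_le (c : l1) i : `|(c : 'rV[R]_n) ord0 i| <= `|c|.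
Proof. by rewrite l1_normE (bigD1 i)//= lerDl sumr_ge0. Qed.

Lemma l1_cauchy_cvg (F : set_system l1) : ProperFilter F -> cauchy F -> cvg F.
Proof.
move=> FF /cauchyP Fc.
pose co i (c : l1) : R := (c : 'rV[R]_n) ord0 i.
have lP i : cvg (co i @ F).
  apply: cauchy_cvg; apply/cauchyP => e e0; have [x Fx] := Fc e e0.
  exists (co i x); suff : F [set y : l1 | ball (co i x) e (co i y)] by [].
  apply: filterS Fx => y; rewrite -!ball_normE/=; apply: le_lt_trans.
  by have := l1_coord_le (x - y) i; rewrite !mxE.
pose l : l1 := (\row_i lim (co i @ F) : 'rV[R]_n).
apply/cvg_ex; exists l; apply/cvgrPdist_le => e e0.
have d0 : 0 < e / n.+1%:R by rewrite divr_gt0.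
have : \forall y \near F, forall i, `|lim (co i @ F) - co i y| <= e / n.+1%:R.
  by apply: filter_forall => i; move: (e / n.+1%:R) d0; apply/cvgrPdist_le; exact: lP.
apply: filterS => y yl; rewrite l1_normE.
apply: (@le_trans _ _ (\sum_(i < n) e / n.+1%:R)).
  by apply: ler_sum => i _; have := yl i; rewrite !mxE.
rewrite sumr_const card_ord -[leLHS]mulr_natl mulrCA ger_pMr//.
by rewrite ler_pdivrMr// mul1r ler_nat.
Qed.

HB.instance Definition _ := Uniform_isComplete.Build l1 l1_cauchy_cvg.

End l1.

(** * Banach-Mazur distance and blocks of l_p(E_n) *)

Section opnorm.
Context (R : realType) (X Y : normedModType R).
Implicit Type T : {linear X -> Y}.

Lemma opnorm_ge T x : `|x| <= 1 -> (`|T x|%:E <= opnorm T)%E.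
Proof. by move=> x1; apply: ereal_sup_ubound; exists x. Qed.

Lemma opnorm_ge0 T : (0 <= opnorm T)%E.
Proof.
by apply: le_trans (@opnorm_ge T 0 _); rewrite ?normr0 ?lee_fin.
Qed.

Lemma opnorm_bound T (a : R) x : opnorm T = a%:E -> `|T x| <= a * `|x|.
Proof.
move=> Ta; have [->|x0] := eqVneq x 0; first by rewrite linear0 !normr0 mulr0.
have : (`|T (`|x|^-1 *: x)|%:E <= a%:E)%E.
  by rewrite -Ta; apply: opnorm_ge; rewrite normrZ normfV normr_id mulVf ?normr_eq0.
rewrite lee_fin linearZ/= normrZ normfV normr_id ler_pdivrMl ?normr_gt0//.
by rewrite mulrC.
Qed.

Lemma opnorm_gt0 T x : T x != 0 -> (0 < opnorm T)%E.
Proof.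
move=> Tx; have x0 : x != 0 by apply: contra_neq Tx => ->; rewrite linear0.
have : `|(`|x|^-1 *: x)| <= 1 by rewrite normrZ normfV normr_id mulVf ?normr_eq0.
move=> /(opnorm_ge T); apply: lt_le_trans.
by rewrite lte_fin normr_gt0 linearZ/= scaler_eq0 negb_or invr_eq0 normr_eq0 x0.
Qed.

Lemma opnorm_le T (K : R) : 0 <= K -> (forall x, `|T x| <= K * `|x|) ->
  (opnorm T <= K%:E)%E.
Proof.
move=> K0 TK; apply: ub_ereal_sup => _ [x /= x1 <-]; rewrite lee_fin.
by rewrite (le_trans (TK x))// ler_piMr.
Qed.

Lemma bounded_linear_cont T (K : R) : (forall x, `|T x| <= K * `|x|) ->
  continuous T.
Proof.
move=> TK; apply/linear_bounded_continuous/linear_boundedP.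
near=> r => x; by apply: le_trans (TK x) _; rewrite ler_wpM2r.
Unshelve. all: by end_near. Qed.

End opnorm.

Section BMdist.
Context (R : realType) (X Y : normedModType R).

Lemma BMdist_le (T : {linear X -> Y}) (S : {linear Y -> X}) (K L : R) :
  cancel T S -> cancel S T -> 0 <= K -> 0 <= L ->
  (forall x, `|T x| <= K * `|x|) -> (forall y, `|S y| <= L * `|y|) ->
  (BMdist X Y <= (K * L)%:E)%E.
Proof.
move=> TS ST K0 L0 TK SL.
apply: (@le_trans _ _ (opnorm T * opnorm S)%E).
  apply: ereal_inf_lbound; exists T, S; split=> //.
    exact: bounded_linear_cont TK.
  exact: bounded_linear_cont SL.
by rewrite EFinM lee_pmul ?opnorm_ge0//; exact: opnorm_le.
Qed.

(** For [T] and [S] with product of norms below [d], take [A = |T| S] and [B = |T|^-1 T], with [|T|]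
    the operator norm. The nonzero [y] makes both operator norms positive, so neither can be
    infinite. *)
Lemma BMdist_lt (d : R) (y : Y) : y != 0 -> (BMdist X Y < d%:E)%E ->
  exists (A : {linear Y -> X}) (B : {linear X -> Y}),
  [/\ cancel A B, cancel B A, forall y, `|A y| <= d * `|y|
    & forall x, `|B x| <= `|x|].
Proof.
move=> y0 /ereal_inf_lt[_ [T [S [_ _ TS ST ->]]]] TSd.
have S0 : (0 < opnorm S)%E.
  apply: (@opnorm_gt0 _ _ _ _ y); apply: contra_neq y0 => Sy.
  by rewrite -(ST y) Sy linear0.
have T0 : (0 < opnorm T)%E by apply: (@opnorm_gt0 _ _ _ _ (S y)); rewrite ST.
case Ta : (opnorm T) T0 TSd => [a||]// T0; last first.
  by rewrite gt0_mulye.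
case Sb : (opnorm S) S0 => [b||]// S0; last by rewrite gt0_muley.
rewrite lte_fin => abd; rewrite !lte_fin in T0 S0.
pose A : {linear Y -> X} := a \*: S; pose B : {linear X -> Y} := a^-1 \*: T.
exists A, B; split => [z|z|z|z].
- by rewrite /A /B/= linearZ/= scalerK ?gt_eqF.
- by rewrite /A /B/= linearZ/= scalerKV ?gt_eqF.
- rewrite /A/= normrZ gtr0_norm//.
  apply: (@le_trans _ _ (a * (b * `|z|))).
    by rewrite ler_pM2l// opnorm_bound.
  by rewrite mulrA ler_wpM2r// ltW.
- rewrite /B/= normrZ gtr0_norm ?invr_gt0// ler_pdivrMl//.
  exact: opnorm_bound.
Qed.

End BMdist.

Section dimension.
Context (R : realType).

Definition unit_row n i : 'rV[R]_n := delta_mx ord0 i.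

(** The images of the free family, written in the spanning family, give a matrix with [n]
    independent rows and [m] columns. *)
Lemma lincomb_injective_dim (F E : normedModType R) n m (e : 'I_n -> F)
    (b : 'I_m -> E) (A : {linear F -> E}) :
  (forall c, lincomb e c = 0 -> c = 0) ->
  (forall v, exists c, v = lincomb b c) -> injective A -> (n <= m)%N.
Proof.
move=> einj bspan Ainj.
have /choice[co coP] := bspan.
pose M := \matrix_(i < n, j < m) co (A (e i)) ord0 j.
have AE u : A (lincomb e u) = lincomb b (u *m M).
  rewrite /lincomb linear_sum; under eq_bigr => i _ do
    rewrite linearZ/= (coP (A (e i))) /lincomb scaler_sumr.
  rewrite exchange_big/=; apply: eq_bigr => j _; rewrite mxE scaler_suml.
  by apply: eq_bigr => i _; rewrite mxE scalerA.
have : row_free M.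
  rewrite -kermx_eq0; apply/eqP/row_matrixP => i; rewrite row0.
  apply: einj; apply: Ainj; rewrite AE linear0 -row_mul mulmx_ker row0.
  by rewrite /lincomb big1// => j _; rewrite mxE scale0r.
by rewrite /row_free => /eqP <-; exact: rank_leq_col.
Qed.

Lemma findim_lincomb (V : normedModType R) n (b : 'I_n -> V) :
  (forall v, exists c, v = lincomb b c) -> finite_dimensional V.
Proof.
move=> bspan; exists n, b => v; have [c ->] := bspan v.
by exists (fun i => c ord0 i).
Qed.

End dimension.

Section selection.
Context (R : realType) (E F : nat -> completeNormedModType R).
Context (E_findim : forall n, finite_dimensional (E n)) (E_dense : BMdense E).
Context (e : forall n, 'I_n.+1 -> F n).
Context (e_span : forall n v, exists c, v = lincomb (@e n) c).
Context (e_free : forall n c, lincomb (@e n) c = 0 -> c = 0).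

(* Taking [F s] of dimension larger than [E_0, ..., E_(N-1)] forces [N <= n]. *)
Lemma BMdense_above (d : R) N r : 0 < d -> exists n s,
  [/\ (N <= n)%N, (r <= s)%N & exists (A : {linear F s -> E n})
    (B : {linear E n -> F s}), [/\ cancel A B, cancel B A,
     forall y, `|A y| <= (1 + d) * `|y| & forall x, `|B x| <= `|x|]].
Proof.
move=> d0.
have [m mP] : exists m, forall j, (j < N)%N -> exists m' (b : 'I_m' -> E j),
    (m' <= m)%N /\ forall v, exists c, v = lincomb b c.
  elim: N => [|N [m mP]]; first by exists 0%N.
  have [m' [b [bs _]]] := findim_basis (E_findim N).
  exists (maxn m m') => j; rewrite ltnS leq_eqVlt => /predU1P[->|/mP[k [c [km cs]]]].
    by exists m', b; rewrite leq_maxr.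
  by exists k, c; split=> //; rewrite (leq_trans km)// leq_maxl.
(* [F s] has dimension [s + 1 > m], so it does not embed into any [E j] with [j < N]. *)
pose s := maxn r m.
have [n nd] := E_dense (findim_lincomb (@e_span s)) d0.
have e0 : @e s ord0 != 0.
  apply/eqP => e0; have : unit_row R (ord0 : 'I_s.+1) = 0.
    apply: (@e_free s); rewrite /lincomb (bigD1 ord0)//= e0 scaler0 add0r big1// => i i0.
    by rewrite mxE eqxx (negbTE i0) scale0r.
  by move=> /rowP/(_ ord0); rewrite !mxE !eqxx => /eqP; rewrite oner_eq0.
have [A [B [AB BA Ad B1]]] := BMdist_lt e0 nd.
exists n, s; split; [|exact: leq_maxl|by exists A, B].
rewrite leqNgt; apply/negP => /mP[m' [b [m'm bs]]].
have := lincomb_injective_dim (@e_free s) bs (can_inj AB).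
by rewrite leqNgt ltnS (leq_trans m'm)// leq_maxr.
Qed.

Lemma BMdense_seq (d : R) (r : nat -> nat) : 0 < d -> exists n s : nat -> nat,
  [/\ forall k, (n k < n k.+1)%N, forall k, (r k <= s k)%N &
   forall k, exists (A : {linear F (s k) -> E (n k)})
    (B : {linear E (n k) -> F (s k)}), [/\ cancel A B, cancel B A,
     forall y, `|A y| <= (1 + d) * `|y| & forall x, `|B x| <= `|x|]].
Proof.
move=> d0.
have /choice[g gP] : forall Nk : nat * nat, exists ns : nat * nat,
    [/\ (Nk.1 <= ns.1)%N, (r Nk.2 <= ns.2)%N &
    exists (A : {linear F ns.2 -> E ns.1})
    (B : {linear E ns.1 -> F ns.2}), [/\ cancel A B, cancel B A,
     forall y, `|A y| <= (1 + d) * `|y| & forall x, `|B x| <= `|x|]].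
  by move=> [N k]; have [n [s ns]] := BMdense_above N (r k) d0; exists (n, s).
(* [N k] is one more than the index chosen for the previous block, so the chosen indices strictly
   increase. *)
pose N := fix N k := if k is k'.+1 then (g (N k', k')).1.+1 else 0%N.
exists (fun k => (g (N k, k)).1), (fun k => (g (N k, k)).2); split=> k.
- by have [] := gP (N k.+1, k.+1).
- by have [] := gP (N k, k).
- by have [] := gP (N k, k).
Qed.

End selection.

Lemma exists_linear (R : realType) (U V : lmodType R) (f : U -> V) :
  (forall a x y, f (a *: x + y) = a *: f x + f y) ->
  exists g : {linear U -> V}, forall x, g x = f x.
Proof.
move=> fl; pose m := GRing.isLinear.Build R U V *:%R f fl.
pose g : {linear U -> V} := HB.pack f m; by exists g.
Qed.

Section spread.
Context (R : realType) (p : R) (p1 : 1 <= p).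
Context (E : nat -> normedModType R) (n : nat -> nat).
Hypothesis n_mono : forall k, (n k < n k.+1)%N.

Let p0 : 0 < p. Proof. exact: lt_le_trans p1. Qed.

Let n_lt k l : (k < l)%N -> (n k < n l)%N.
Proof.
elim: l => // l IH; rewrite ltnS leq_eqVlt => /predU1P[->//|/IH kl].
exact: ltn_trans kl (n_mono _).
Qed.

Let n_inj k l : n k = n l -> k = l.
Proof.
by have [/n_lt|/n_lt|//] := ltngtP k l => kl nkl; rewrite nkl ltnn in kl.
Qed.

Let n_ge k : (k <= n k)%N.
Proof. by elim: k => // k IH; exact: leq_ltn_trans IH (n_mono _). Qed.

(** The value at [j] has type [E j], so [v k] is transported along [n k = j]. Injectivity of [n] and
    proof irrelevance make the result independent of [k] and of the proof. *)
Lemma spread_exists (v : forall k, E (n k)) : exists y : forall j, E j,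
  (forall k, y (n k) = v k) /\ (forall j, (forall k, n k <> j) -> y j = 0).
Proof.
have H j : {w : E j | (forall k (e : n k = j), w = eq_rect _ E (v k) _ e) /\
    ((forall k, n k <> j) -> w = 0)}.
  apply: cid; have [[k kj]|jn] := pselect (exists k, n k = j); last first.
    by exists 0; split=> // k kj; case: jn; exists k.
  subst j; exists (v k); split=> [l e|/(_ k)//].
  by have lk := n_inj e; subst l; rewrite (Prop_irrelevance e erefl).
exists (fun j => sval (H j)); split=> [k|j].
  by have [/(_ k erefl) -> _] := svalP (H (n k)).
by have [_] := svalP (H j).
Qed.

Lemma spread_sum (v : forall k, E (n k)) (y : forall j, E j) K :
  (forall k, y (n k) = v k) -> (forall j, (forall k, n k <> j) -> y j = 0) ->
  \sum_(0 <= i < n K) `|y i| `^ p = \sum_(0 <= k < K) `|v k| `^ p.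
Proof.
move=> yv y0.
have z a b : (forall i, (a <= i < b)%N -> forall k, n k <> i) ->
    \sum_(a <= i < b) `|y i| `^ p = 0.
  move=> ab; rewrite big_nat big1// => i /ab/y0 ->.
  by rewrite normr0 powR0// gt_eqF.
elim: K => [|K IH].
  rewrite [RHS]big_geq// z// => i /andP[_ i0] k ki.
  rewrite -ki in i0; have [k0|k0] := posnP k; first by rewrite k0 ltnn in i0.
  by have := ltn_trans (n_lt k0) i0; rewrite ltnn.
rewrite (big_cat_nat (leq0n _) (ltnW (n_mono K)))/= IH big_nat_recr//=; congr (_ + _).
rewrite big_ltn// yv z ?addr0// => i /andP[i1 i2] k ki.
rewrite -ki in i1 i2; have [kK|kK] := leqP k K.
  move: i1; rewrite ltnNge; move: kK; rewrite leq_eqVlt => /predU1P[->|/n_lt/ltnW ->//].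
  by rewrite leqnn.
move: i2; rewrite ltnNge; move: kK; rewrite leq_eqVlt => /predU1P[->|/n_lt/ltnW ->//].
by rewrite leqnn.
Qed.

Lemma lp_spread (v : lp_sum (fun k => E (n k)) p1) : exists y : lp_sum E p1,
  [/\ forall k, y (n k) = v k, forall j, (forall k, n k <> j) -> y j = 0
    & `|y| <= `|v|].
Proof.
have [y [yv y0]] := spread_exists v.
have [|z zy zv] := @lp_exists R p p1 E y `|v| (normr_ge0 _).
  move=> m; apply: (@le_trans _ _ (\sum_(0 <= i < n m) `|y i| `^ p)).
    rewrite (big_cat_nat (leq0n _) (n_ge m))/= lerDl.
    by apply: sumr_ge0 => i _; exact: powR_ge0.
  by rewrite (spread_sum m yv y0) lp_norm_sum_le.
exists z; split=> [k|j jn|//]; first by rewrite zy.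
by rewrite zy; exact: y0.
Qed.

Lemma lp_restrict (y : lp_sum E p1) : exists v : lp_sum (fun k => E (n k)) p1,
  (forall k, v k = y (n k)) /\ `|v| <= `|y|.
Proof.
have [|z zy zv] := @lp_exists R p p1 (fun k => E (n k)) (fun k => y (n k)) `|y|
  (normr_ge0 _); last by exists z.
move=> m; apply: le_trans (lp_norm_sum_le y (n m)).
elim: m => [|m IH]; first by rewrite big_geq// sumr_ge0// => i _; exact: powR_ge0.
rewrite big_nat_recr//= (big_cat_nat (leq0n _) (ltnW (n_mono m)))/= lerD//.
by rewrite big_ltn// lerDl sumr_ge0// => i _; exact: powR_ge0.
Qed.

Context (F : nat -> normedModType R) (A : forall k, {linear F k -> E (n k)}).
Context (B : forall k, {linear E (n k) -> F k}) (D : R).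
Hypothesis AB : forall k, cancel (A k) (B k).
Hypothesis D0 : 0 < D.
Hypothesis A_le : forall k y, `|A k y| <= D * `|y|.
Hypothesis B_le : forall k x, `|B k x| <= `|x|.

(** [Phi] puts [A k (w k)] at coordinate [n k] and zero elsewhere; [Psi] applies [B k] to coordinate
    [n k]. Thus [Phi \o Psi] is a projection of norm at most [D] onto a copy of the sum of the
    [F k]. *)
Lemma lp_factor : exists (Phi : {linear lp_sum F p1 -> lp_sum E p1})
  (Psi : {linear lp_sum E p1 -> lp_sum F p1}),
  [/\ cancel Phi Psi, forall w, `|Phi w| <= D * `|w| & forall x, `|Psi x| <= `|x|].
Proof.
have /choice[f fP] : forall w : lp_sum F p1, exists y : lp_sum E p1,
    [/\ forall k, y (n k) = A k (w k), forall j, (forall k, n k <> j) -> y j = 0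
    & `|y| <= D * `|w|].
  move=> w.
  have Dw : `|(D *: w)| = D * `|w| by rewrite normrZ gtr0_norm.
  have [|v vA vw] := @lp_exists_dom R p p1 (fun k => E (n k)) F (fun k => A k (w k)) (D *: w).
    by move=> k; rewrite lp_valZ normrZ gtr0_norm.
  have [y [yv y0 yle]] := lp_spread v; exists y; split=> // [k|]; first by rewrite yv vA.
  by rewrite -Dw (le_trans yle).
have /choice[g gP] : forall x : lp_sum E p1, exists w : lp_sum F p1,
    (forall k, w k = B k (x (n k))) /\ `|w| <= `|x|.
  move=> x; have [v [vx vle]] := lp_restrict x.
  have [|w wB wv] := @lp_exists_dom R p p1 F (fun k => E (n k)) (fun k => B k (x (n k))) v.
    by move=> k; rewrite vx.
  by exists w; split=> //; exact: le_trans vle.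
have [|Phi PhiE] := @exists_linear R _ _ f.
  move=> a x y; apply: lp_val_inj => j.
  have [fx fx0 _] := fP x; have [fy fy0 _] := fP y.
  have [fxy fxy0 _] := fP (a *: x + y); rewrite lp_valD lp_valZ.
  have [[k <-]|jn] := pselect (exists k, n k = j).
    by rewrite fxy fx fy lp_valD lp_valZ linearP.
  have jk k : n k <> j by move=> kj; apply: jn; exists k.
  by rewrite fxy0// fx0// fy0// scaler0 addr0.
have [|Psi PsiE] := @exists_linear R _ _ g.
  move=> a x y; apply: lp_val_inj => k.
  rewrite lp_valD lp_valZ (gP _).1 (gP x).1 (gP y).1.
  by rewrite lp_valD lp_valZ linearP.
exists Phi, Psi; split=> [w|w|x].
- apply: lp_val_inj => k; rewrite PsiE PhiE (gP _).1.
  by have [-> _ _] := fP w; rewrite AB.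
- by rewrite PhiE; have [] := fP w.
- by rewrite PsiE (gP _).2.
Qed.

End spread.

Section factor.
Context (R : realType) (p : R) (p1 : 1 <= p).
Context (E F : nat -> completeNormedModType R).
Context (E_findim : forall n, finite_dimensional (E n)) (E_dense : BMdense E).
Context (e : forall n, 'I_n.+1 -> F n).
Context (e_span : forall n v, exists c, v = lincomb (@e n) c).
Context (e_free : forall n c, lincomb (@e n) c = 0 -> c = 0).

Lemma lp_factor_dense (d : R) (r : nat -> nat) : 0 < d -> exists s : nat -> nat,
  (forall k, (r k <= s k)%N) /\
  exists (Phi : {linear lp_sum (fun k => F (s k)) p1 -> lp_sum E p1})
  (Psi : {linear lp_sum E p1 -> lp_sum (fun k => F (s k)) p1}),
  [/\ cancel Phi Psi, forall w, `|Phi w| <= (1 + d) * `|w|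
    & forall x, `|Psi x| <= `|x|].
Proof.
move=> d0; have [n [s [n_mono rs AB]]] :=
  BMdense_seq E_findim E_dense e_span e_free r d0.
exists s; split=> //.
have D0 : 0 < 1 + d by rewrite addr_gt0.
pose S k := cid (AB k); pose T k := cid (projT2 (S k)).
apply: (@lp_factor R p p1 E n n_mono (fun k => F (s k)) (fun k => projT1 (S k))
  (fun k => projT1 (T k)) (1 + d)) => // k; by have [] := projT2 (T k).
Qed.

End factor.

Definition l1_basis (R : realType) n (i : 'I_n) : l1 R n := delta_mx ord0 i.

Lemma l1_lincomb (R : realType) n (c : 'rV[R]_n) :
  lincomb (@l1_basis R n) c = c.
Proof.
rewrite [RHS]row_sum_delta; apply: eq_bigr => i _.
by [].
Qed.

Lemma rV_lincomb (R : realType) n (c : 'rV[R]_n) :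
  lincomb (fun i : 'I_n => delta_mx ord0 i : 'rV[R]_n) c = c.
Proof. by rewrite [RHS]row_sum_delta. Qed.

(** * Cut-offs almost preserving a subspace *)

Section lp_mul.
Context (R : realType) (p : R) (p1 : 1 <= p) (E : nat -> normedModType R).
Local Notation L := (lp_sum E p1).

(* The value is [0] when [a_n x_n] is not in the l_p-sum; all uses have
   [|a_n| <= 1]. *)
Definition lp_mul (a : nat -> R) (x : L) : L :=
  if pselect (exists z : L, forall i, z i = a i *: x i) is left h
  then sval (cid h) else 0.

Lemma lp_mulE a x i : (forall i, `|a i| <= 1) -> lp_mul a x i = a i *: x i.
Proof.
move=> a1; rewrite /lp_mul; case: pselect => [h|[]]; first exact: (svalP (cid h)).
have [|z zx _] := @lp_exists_dom R p p1 E E (fun i => a i *: x i) x; last by exists z.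
by move=> j; rewrite normrZ ler_piMl.
Qed.

Lemma lp_mulP a b x y : (forall i, `|a i| <= 1) ->
  lp_mul a (b *: x + y) = b *: lp_mul a x + lp_mul a y.
Proof.
move=> a1; apply: lp_val_inj => i.
by rewrite lp_mulE// !lp_valD !lp_valZ !lp_mulE// scalerDr !scalerA mulrC.
Qed.

Lemma lp_truncZ n a (x : L) : lp_trunc p1 n (a *: x) = a *: lp_trunc p1 n x.
Proof.
apply: lp_val_inj => i; rewrite lp_valZ !lp_truncE.
by case: ifP => _; rewrite ?scaler0 ?lp_valZ.
Qed.

Lemma lp_trunc0 n : lp_trunc p1 n (0 : L) = 0.
Proof. by apply: lp_val_inj => i; rewrite lp_truncE; case: ifP. Qed.

End lp_mul.

Section cutoff.
Context (R : realType) (p : R) (p1 : 1 <= p) (E : nat -> normedModType R).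
Context (E_findim : forall n, finite_dimensional (E n)).
Local Notation L := (lp_sum E p1).

Lemma coord_coloring m (M e : R) : 0 < e ->
  exists (I : finType) (c : L -> I), forall x y : L,
    `|x| <= M -> `|y| <= M -> c x = c y ->
    forall i, (i < m)%N -> `|x i - y i| <= e.
Proof.
move=> e0; elim: m => [|m [I [c cP]]]; first by exists unit, (fun=> tt).
have [J [d dP]] := findim_coloring M (E_findim m) e0.
exists (I * J)%type, (fun x => (c x, d (x m))) => x y xM yM [cxy dxy] i.
rewrite ltnS leq_eqVlt => /predU1P[->|]; last exact: cP.
by apply: dP => //; exact: le_trans (lp_coord_le _ _) _.
Qed.

(** One representative in [B] is chosen for each colour. The family [t] is total on [nat], with [0]
    for absent colours and large indices, so it stays in [B] and blocks may later be longer than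
    [N]. *)
Lemma lp_trunc_net m (M e : R) (B : set L) : B 0 ->
  (forall x, B x -> `|x| <= M) -> 0 < e ->
  exists (N : nat) (t : nat -> L), (forall k, B (t k)) /\
    forall x, B x -> exists2 k, (k < N)%N & `|lp_trunc p1 m (x - t k)| <= e.
Proof.
move=> B0 BM e0.
have e'0 : 0 < e / m.+1%:R by rewrite divr_gt0.
have [I [c cP]] := coord_coloring m M e'0.
have /choice[t tP] : forall i, exists z, B z /\ forall x, B x -> c x = i -> c z = i.
  move=> i; have [[z [Bz cz]]|zN] := pselect (exists z, B z /\ c z = i).
    by exists z.
  by exists 0; split=> // x Bx cx; case: zN; exists x.
exists #|I|, (fun k => nth 0 [seq t i | i <- enum I] k); split=> [k|x Bx].
  have [kI|kI] := ltnP k (size [seq t i | i <- enum I]); last by rewrite nth_default.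
  by have /mapP[i _ ->] := mem_nth 0 kI; exact: (tP i).1.
exists (index (c x) (enum I)); first by rewrite cardE index_mem mem_enum.
rewrite (nth_map (c x)) ?index_mem ?mem_enum// nth_index ?mem_enum//.
have [Bt /(_ x Bx erefl) ct] := tP (c x).
apply: (@le_trans _ _ (m%:R * (e / m.+1%:R))).
  apply: lp_trunc_small; first exact: ltW.
  by move=> i im; rewrite lp_valB; apply: cP im; rewrite ?ct// BM.
by rewrite mulrCA ger_pMr// ler_pdivrMr// mul1r ler_nat.
Qed.

Context (Y : closedSubspace L).

(** [z] is [|y|] times a point of a finite net of the unit ball of [Y], close to [y / |y|] on the
    first [m] coordinates. Finiteness yields one [n] beyond which all net points have small tails,
    uniformly in [y]. *)
Lemma uniform_split m (e : R) : 0 < e -> exists n, (m < n)%N /\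
  forall y, y \in Y -> exists z, [/\ z \in Y, `|z| <= `|y|,
    `|lp_trunc p1 m (y - z)| <= e * `|y| & `|z - lp_trunc p1 n z| <= e * `|y|].
Proof.
move=> e0; pose B : set L := [set x | x \in Y /\ `|x| <= 1].
have [||N [t [Bt tP]]] := @lp_trunc_net m 1 e B _ _ e0.
- by split; rewrite ?normr0// rpred0.
- by move=> x [].
have [n [mn nP]] : exists n, (m < n)%N /\ forall k, (k < N)%N ->
    forall l, (n <= l)%N -> `|t k - lp_trunc p1 l (t k)| <= e.
  elim: N {tP} => [|N [n [mn nP]]]; first by exists m.+1.
  have [n' n'P] := lp_trunc_cvg (t N) e0.
  exists (maxn n n'); split=> [|k kN l]; first by rewrite leq_max mn.
  rewrite geq_max => /andP[nl n'l]; move: kN.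
  by rewrite ltnS leq_eqVlt => /predU1P[->|/nP]; [exact: n'P|exact].
exists n; split=> // y yY.
have [->|y0] := eqVneq y 0.
  by exists 0; rewrite !subr0 !lp_trunc0 subr0 !normr0 mulr0 rpred0.
have ny : 0 < `|y| by rewrite normr_gt0.
have [|k kN kP] := tP (`|y|^-1 *: y).
  by split; [exact: rpredZ|rewrite normrZ normfV normr_id mulVf// normr_eq0].
have [tY t1] := Bt k.
exists (`|y| *: t k); split.
- exact: rpredZ.
- by rewrite normrZ normr_id ler_piMr.
- have -> : y - `|y| *: t k = `|y| *: (`|y|^-1 *: y - t k).
    by rewrite scalerBr scalerKV ?gt_eqF.
  by rewrite lp_truncZ normrZ normr_id mulrC ler_pM2r.
- by rewrite lp_truncZ -scalerBr normrZ normr_id mulrC ler_pM2r// nP.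
Qed.


Hypothesis p_gt1 : 1 < p.

Let p0 : 0 < p. Proof. exact: lt_trans p_gt1. Qed.

(** The condition amounts to [h^(-p) <= N^(p-1)], which holds for large [N] as [p > 1]. It says that
    the factor [N^(1/p)] coming from [N] disjoint blocks is at most [N h]. *)
Lemma root_beats_linear (h : R) : 0 < h ->
  exists2 N : nat, (0 < N)%N & N%:R <= (N%:R * h) `^ p.
Proof.
move=> h0; have q0 : 0 < p - 1 by rewrite subr_gt0.
pose K := (h^-1 `^ p) `^ (p - 1)^-1.
exists (Num.truncn K).+1 => //; set N := _.+1.
have KN : K <= N%:R by apply/ltW/truncnS_gt.
have N0 : 0 < N%:R :> R by rewrite ltr0n.
have : K `^ (p - 1) <= N%:R `^ (p - 1).
  by apply: ge0_ler_powR => //; rewrite ?nnegrE ?powR_ge0// ltW.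
rewrite -powRrM mulVf ?gt_eqF// powRr1 ?powR_ge0// => KN'.
rewrite (powRM _ (ltW N0) (ltW h0)).
have -> : N%:R `^ p = N%:R `^ (p - 1) * N%:R.
  by rewrite -[X in _ * X](powRr1 (ltW N0)) -powRD ?subrK// gt_eqF// implybT.
rewrite mulrAC -[leLHS]mul1r; apply: ler_wpM2r; first exact: ltW.
apply: le_trans (ler_wpM2r _ KN'); last exact: powR_ge0.
by rewrite -powRM ?invr_ge0 ?(ltW h0)// mulVf ?gt_eqF// powR1.
Qed.

(** The blocks [mm s <= i < mm s.+1] are disjoint, so at each coordinate at most one summand is
    nonzero and [p]-th powers of norms add up. *)
Lemma lp_blocks_le (N : nat) (mm : nat -> nat) (z : nat -> L) (y : L) :
  (forall s, (mm s <= mm s.+1)%N) -> (forall s, `|z s| <= `|y|) ->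
  `|\sum_(s < N) (lp_trunc p1 (mm s.+1) (z s) - lp_trunc p1 (mm s) (z s))| `^ p
    <= N%:R * `|y| `^ p.
Proof.
move=> mono zy.
have mle s t : (s <= t)%N -> (mm s <= mm t)%N.
  exact: (homo_leq leqnn leq_trans mono).
have Ny0 : 0 <= N%:R * `|y| `^ p by rewrite mulr_ge0// powR_ge0.
rewrite -[leRHS](powR_root p1)// powR_le2 ?powR_ge0//.
apply: lp_norm_le => [|n]; first exact: powR_ge0.
rewrite (powR_root p1)//.
apply: (@le_trans _ _ (\sum_(0 <= i < n) \sum_(s < N) `|z s i| `^ p)).
  apply: ler_sum => i _; rewrite lp_val_sum.
  have term0 (s : 'I_N) : ~~ (mm s <= i < mm s.+1)%N ->
      (lp_trunc p1 (mm s.+1) (z s) - lp_trunc p1 (mm s) (z s)) i = 0.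
    rewrite lp_valB !lp_truncE negb_and -ltnNge -leqNgt => /orP[im|mi].
      by rewrite im (leq_trans im (mono s)) subrr.
    by rewrite !ltnNge mi (leq_trans (mono s) mi)/= subrr.
  have [[s sP]|sN] := pselect (exists s : 'I_N, (mm s <= i < mm s.+1)%N); last first.
    rewrite big1 => [|s _]; last by apply: term0; apply/negP => si; apply: sN; exists s.
    rewrite normr0 powR0 ?gt_eqF// sumr_ge0// => s _; exact: powR_ge0.
  rewrite (bigD1 s)//= big1 ?addr0 => [|t ts]; last first.
    apply: term0; apply/negP => /andP[t1 t2]; move: sP => /andP[s1 s2].
    have [st|st|/val_inj st] := ltngtP s t; last by rewrite st eqxx in ts.
      by have := leq_trans s2 (leq_trans (mle _ _ st) t1); rewrite ltnn.
    by have := leq_trans t2 (leq_trans (mle _ _ st) s1); rewrite ltnn.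
  move: sP => /andP[s1 s2].
  rewrite /seq_trunc s2 ltnNge s1 subr0 (bigD1 s)//= lerDl.
  by apply: sumr_ge0 => t _; exact: powR_ge0.
rewrite exchange_big/=; apply: (@le_trans _ _ (\sum_(s < N) `|y| `^ p)).
  apply: ler_sum => s _; apply: le_trans (lp_norm_sum_le _ _) _.
  by rewrite powR_le2.
by rewrite sumr_const card_ord mulr_natl.
Qed.

(* Averaging sharp cuts located in [N] consecutive blocks: in each block the
   vector close to the cut of [y] is only bounded, but the blocks are disjoint
   and [p > 1], so these errors average out. *)
Lemma cutoff m (e : R) : 0 < e -> exists n (psi : nat -> R),
  [/\ (m < n)%N, forall i, 0 <= psi i <= 1, forall i, (i < m)%N -> psi i = 1,
    forall i, (n <= i)%N -> psi i = 0 &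
    forall y, y \in Y -> exists2 u, u \in Y & `|lp_mul psi y - u| <= e * `|y|].
Proof.
move=> e0; pose h := e / 2; have h0 : 0 < h by rewrite divr_gt0.
have h20 : 0 < h / 2 by rewrite divr_gt0.
have [N N0 NP] := root_beats_linear h0.
have NR0 : 0 < N%:R :> R by rewrite ltr0n.
have /choice[nx nxP] := fun m => uniform_split m h20.
pose mm s := iter s nx m.
have mono s : (mm s < mm s.+1)%N by exact: (nxP _).1.
have mle s t : (s <= t)%N -> (mm s <= mm t)%N.
  exact: (homo_leq leqnn leq_trans (fun k => ltnW (mono k))).
(* The mean of the indicators of the initial segments of lengths [mm 0, ..., mm (N-1)]. *)
pose psi i : R := N%:R^-1 * \sum_(s < N) (i < mm s)%N%:R.
have psi01 i : 0 <= psi i <= 1.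
  rewrite mulr_ge0 ?invr_ge0 ?sumr_ge0//= ler_pdivrMl// mulr1.
  rewrite (le_trans (_ : _ <= \sum_(s < N) 1))//; last by rewrite sumr_const card_ord.
  by apply: ler_sum => s _; rewrite lern1 leq_b1.
have psi1 i : `|psi i| <= 1 by have /andP[? ?] := psi01 i; rewrite ger0_norm.
exists (mm N), psi; split=> //.
- by apply: leq_trans (mono 0%N) _; exact: mle.
- move=> i im; rewrite /psi (eq_bigr (fun=> 1)) => [|s _].
    by rewrite sumr_const card_ord mulVf ?gt_eqF.
  by rewrite (leq_trans im)// (mle 0%N).
- move=> i iN; rewrite /psi big1 ?mulr0// => s _.
  by rewrite ltnNge (leq_trans _ iN)// mle// ltnW.
move=> y yY.
have /choice[z zP] := fun s => (nxP (mm s)).2 y yY.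
exists (N%:R^-1 *: \sum_(s < N) z s).
  by rewrite rpredZ// rpred_sum// => s _; have [] := zP s.
(* The cut of [y] at [mm s] minus [z s] splits into the error on the first [mm s] coordinates, the
   tail of [z s] from [mm s.+1] on, and the part of [z s] in the [s]-th block. The first two are at
   most [(h / 2) |y|] each. *)
have -> : lp_mul psi y - N%:R^-1 *: (\sum_(s < N) z s) =
    N%:R^-1 *: (\sum_(s < N) (lp_trunc p1 (mm s) (y - z s) -
      (z s - lp_trunc p1 (mm s.+1) (z s))) -
      \sum_(s < N) (lp_trunc p1 (mm s.+1) (z s) - lp_trunc p1 (mm s) (z s))).
  apply: lp_val_inj => i; rewrite lp_valB lp_mulE// !lp_valZ /psi -scalerA -scalerBr.
  congr (_ *: _); rewrite lp_valB !lp_val_sum scaler_suml -!sumrB.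
  apply: eq_bigr => s _; rewrite !lp_valB !lp_truncE lp_valB.
  set a : E i := if (i < mm s.+1)%N then z s i else 0.
  case: ifP => _; rewrite ?scale1r ?scale0r.
    by rewrite opprB -[RHS]addrA -[a - z s i]opprB subrr addr0.
  by rewrite subr0 !sub0r opprB addrAC subrr sub0r.
rewrite normrZ gtr0_norm ?invr_gt0// ler_pdivrMl//.
rewrite (splitr e) -/h mulrDl mulrDr (le_trans (ler_normB _ _))// lerD//.
  apply: (@le_trans _ _ (\sum_(s < N) (h * `|y|))); last first.
    by rewrite sumr_const card_ord mulr_natl.
  apply: le_trans (ler_norm_sum _ _ _) _; apply: ler_sum => s _.
  rewrite (splitr h) mulrDl (le_trans (ler_normB _ _))// lerD//.
    by have [] := zP s.
  by have [] := zP s.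
(* Together the blocks have norm at most [N^(1/p) |y|], hence at most [N h |y|] by the choice of
   [N]. *)
rewrite -(powR_le2 p1) ?mulr_ge0 ?(ltW h0) ?(ltW e0)//.
apply: (@le_trans _ _ (N%:R * `|y| `^ p)).
  by apply: lp_blocks_le => s; [exact: ltnW (mono s)|have [] := zP s].
rewrite mulrA powRM ?normr_ge0//; last by rewrite mulr_ge0 ?(ltW h0).
by rewrite ler_wpM2r// powR_ge0.
Qed.


(** [phi k] is the difference of two successive cut-offs, each equal to [1] on the support of the
    previous one, so the sums telescope to a cut-off. *)
Lemma cutoff_partition (eta : nat -> R) : (forall k, 0 < eta k) ->
  exists (phi : nat -> nat -> R) (M : nat -> nat),
  [/\ forall k i, 0 <= phi k i <= 1, forall k i, (M k <= i)%N -> phi k i = 0,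
    forall K i, \sum_(k < K) phi k i <= 1,
    forall K i, (i < K)%N -> \sum_(k < K) phi k i = 1 &
    forall k y, y \in Y ->
      exists2 u, u \in Y & `|lp_mul (phi k) y - u| <= eta k * `|y|].
Proof.
(* The [k]-th cut-off enters both [phi k] and [phi k.+1], so its error must be at most half of
   either tolerance. *)
move=> eta0; pose e k := Order.min (eta k) (eta k.+1) / 2.
have e0 k : 0 < e k by rewrite /e divr_gt0 ?lt_min ?eta0.
have /choice[c cP] : forall km : nat * nat, exists np : nat * (nat -> R),
  [/\ (km.2 < np.1)%N, forall i, 0 <= np.2 i <= 1, forall i, (i < km.2)%N -> np.2 i = 1,
    forall i, (np.1 <= i)%N -> np.2 i = 0 &
    forall y, y \in Y -> exists2 u, u \in Y & `|lp_mul np.2 y - u| <= e km.1 * `|y|].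
  by move=> [k m]; have [n [psi H]] := cutoff m (e0 k); exists (n, psi).
(* [psi k] will be [1] before [m k] and [0] from [m k.+1] on; starting at [1] gives [k < m k]. *)
pose m := fix m k := if k is k'.+1 then (c (k', m k')).1 else 1%N.
pose psi k := (c (k, m k)).2.
have mono k : (m k < m k.+1)%N by have [] := cP (k, m k).
have mk k : (k < m k)%N by elim: k => // k IH; exact: leq_ltn_trans IH (mono k).
have psi01 k i : 0 <= psi k i <= 1 by have [_ + _ _ _] := cP (k, m k); apply.
have psi1 k i : (i < m k)%N -> psi k i = 1 by have [_ _ + _ _] := cP (k, m k); apply.
have psi0 k i : (m k.+1 <= i)%N -> psi k i = 0.
  by have [_ _ _ + _] := cP (k, m k); apply.
pose phi k i := psi k i - (if k is k'.+1 then psi k' i else 0).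
have phi_sum K i : \sum_(k < K.+1) phi k i = psi K i.
  elim: K => [|K IH]; first by rewrite big_ord1 /phi subr0.
  by rewrite big_ord_recr/= IH /phi addrC subrK.
have phi01 k i : 0 <= phi k i <= 1.
  rewrite /phi; case: k => [|k]; first by rewrite subr0.
  have /andP[a b] := psi01 k i; have /andP[a' b'] := psi01 k.+1 i.
  have [ik|ik] := ltnP i (m k.+1); first by rewrite psi1// subr_ge0 b gerBl a.
  by rewrite (psi0 k)// subr0 a' b'.
exists phi, (fun k => m k.+1); split=> //.
- move=> k i mi; rewrite /phi psi0//; case: k mi => [|k] mi; first by rewrite subr0.
  by rewrite psi0 ?subr0// (leq_trans _ mi)// ltnW.
- by case=> [|K] i; [rewrite big_ord0|rewrite phi_sum; have /andP[] := psi01 K i].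
- by case=> // K i iK; rewrite phi_sum psi1// (leq_ltn_trans _ (mk K)).
move=> k y yY.
have psin j i : `|psi j i| <= 1 by have /andP[? ?] := psi01 j i; rewrite ger0_norm.
have phin j i : `|phi j i| <= 1 by have /andP[? ?] := phi01 j i; rewrite ger0_norm.
have up j : exists2 u, u \in Y & `|lp_mul (psi j) y - u| <= e j * `|y|.
  by have [_ _ _ _] := cP (j, m j); apply.
have emin j : e j <= eta j / 2 /\ e j <= eta j.+1 / 2.
  by split; rewrite ler_pM2r// ge_min lexx ?orbT.
case: k => [|k].
  have [u uY uy] := up 0%N; exists u => //.
  have -> : lp_mul (phi 0%N) y = lp_mul (psi 0%N) y.
    by apply: lp_val_inj => i; rewrite !lp_mulE// /phi subr0.
  apply: le_trans uy _; rewrite ler_wpM2r//.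
  by have := eta0 0%N; have := (emin 0%N).1; lra.
have [u uY uy] := up k.+1; have [v vY vy] := up k.
exists (u - v); first by rewrite rpredB.
have -> : lp_mul (phi k.+1) y - (u - v) =
    (lp_mul (psi k.+1) y - u) - (lp_mul (psi k) y - v).
  apply: lp_val_inj => i; rewrite !lp_valB !lp_mulE// /phi scalerBl.
  by rewrite !opprB [LHS]addrACA [RHS]addrACA; congr (_ + _); exact: addrC.
rewrite (le_trans (ler_normB _ _))// (le_trans (lerD uy vy))// -mulrDl ler_wpM2r//.
by have := (emin k.+1).1; have := (emin k).2; lra.
Qed.

End cutoff.

(** * Jensen's inequality and the seminorms [N_k] *)

Section jensen.
Context (R : realType) (p : R) (p1 : 1 <= p).

Let p0 : 0 < p. Proof. exact: lt_le_trans p1. Qed.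

Lemma powR_convex2 (a s t : R) : 0 <= a <= 1 -> 0 <= s -> 0 <= t ->
  (a * s + (1 - a) * t) `^ p <= a * s `^ p + (1 - a) * t `^ p.
Proof.
move=> /andP[a0 a1] s0 t0.
have := convex_powR p1 (Itv01 a0 a1) (x := s) (y := t).
rewrite !inE/= !in_itv/= !andbT s0 t0 => /(_ isT isT).
by rewrite !convRE.
Qed.

(** Two-point convexity splits off the last weight; the others, divided by [1 - w K], still sum to
    at most [1]. If [w K = 1], the others vanish. *)
Lemma powR_jensen K (w t : nat -> R) : (forall k, 0 <= w k) ->
  (forall k, 0 <= t k) -> \sum_(k < K) w k <= 1 ->
  (\sum_(k < K) w k * t k) `^ p <= \sum_(k < K) w k * t k `^ p.
Proof.
move=> + t0; elim: K w => [|K IH] w w0 w1; first by rewrite !big_ord0 powR0 ?gt_eqF.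
rewrite !big_ord_recr/= in w1 *.
have s0 : 0 <= \sum_(k < K) w k by rewrite sumr_ge0.
have [wK|wK] := eqVneq (w K) 1.
  have wk0 (k : 'I_K) : w k = 0.
    apply/eqP; rewrite eq_le w0 andbT; apply: le_trans (_ : \sum_(k < K) w k <= 0).
      by rewrite (bigD1 k)//= lerDl sumr_ge0.
    by move: w1; rewrite wK; lra.
  rewrite !big1 ?add0r => [|k _|k _]; rewrite ?wk0 ?mul0r//.
  by rewrite wK !mul1r.
have wK1 : 0 < 1 - w K.
  by rewrite subr_gt0 lt_neqAle wK/=; apply: le_trans w1; rewrite lerDr.
pose v k := (1 - w K)^-1 * w k.
have v0 k : 0 <= v k by rewrite mulr_ge0// invr_ge0 ltW.
have v1 : \sum_(k < K) v k <= 1.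
  by rewrite -mulr_sumr ler_pdivrMl// mulr1 lerBrDr.
have wE (f : nat -> R) : \sum_(k < K) w k * f k = (1 - w K) * \sum_(k < K) v k * f k.
  rewrite mulr_sumr; apply: eq_bigr => k _.
  by rewrite /v !mulrA divff ?gt_eqF// mul1r.
rewrite wE (wE (fun k => t k `^ p)) addrC [leRHS]addrC.
apply: le_trans (powR_convex2 _ (t0 K) _) _.
- by rewrite w0/= -subr_ge0 ltW.
- by rewrite sumr_ge0// => k _; rewrite mulr_ge0.
by rewrite lerD2l ler_wpM2l ?(ltW wK1)//; exact: IH.
Qed.

End jensen.

Section weighted.
Context (R : realType) (p : R) (p1 : 1 <= p) (E : nat -> normedModType R).
Local Notation L := (lp_sum E p1).
Context (phi : nat -> nat -> R) (M : nat -> nat).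
Hypothesis phi01 : forall k i, 0 <= phi k i <= 1.
Hypothesis phi_supp : forall k i, (M k <= i)%N -> phi k i = 0.
Hypothesis phi_sum : forall K i, \sum_(k < K) phi k i <= 1.
Hypothesis phi_sum1 : forall K i, (i < K)%N -> \sum_(k < K) phi k i = 1.

Let p0 : 0 < p. Proof. exact: lt_le_trans p1. Qed.
Let phi0 k i : 0 <= phi k i. Proof. by have /andP[] := phi01 k i. Qed.

Lemma phi_norm k i : `|phi k i| <= 1.
Proof. by have /andP[a b] := phi01 k i; rewrite ger0_norm. Qed.

Lemma phi_root_norm k i : `|phi k i `^ p^-1| <= 1.
Proof.
rewrite ger0_norm ?powR_ge0// -(powR_le2 p1) ?powR_ge0// (powR_root p1)// powR1.
by have /andP[] := phi01 k i.
Qed.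

(** The seminorm [N_k]; its [p]-th power is the sum over [i] of [phi k i] times [|x i|^p]. *)
Definition wnorm k (x : L) : R := `|lp_mul (fun i => phi k i `^ p^-1) x|.

Lemma wnorm_ge0 k x : 0 <= wnorm k x. Proof. exact: normr_ge0. Qed.

Lemma wnormD k x y : wnorm k (x + y) <= wnorm k x + wnorm k y.
Proof.
rewrite /wnorm -[x in x + y]scale1r lp_mulP; last exact: phi_root_norm.
by rewrite scale1r ler_normD.
Qed.

Lemma lp_mul0 (a : nat -> R) : (forall i, `|a i| <= 1) -> lp_mul a (0 : L) = 0.
Proof. by move=> a1; apply: lp_val_inj => i; rewrite lp_mulE// scaler0. Qed.

Lemma wnormZ k a x : wnorm k (a *: x) = `|a| * wnorm k x.
Proof.
rewrite /wnorm -[a *: x]addr0 lp_mulP; last exact: phi_root_norm.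
by rewrite lp_mul0 ?addr0 ?normrZ//; exact: phi_root_norm.
Qed.

Lemma wnorm_coord k (x : L) i :
  `|lp_mul (fun i => phi k i `^ p^-1) x i| `^ p = phi k i * `|x i| `^ p.
Proof.
rewrite lp_mulE; last exact: phi_root_norm.
by rewrite normrZ ger0_norm ?powR_ge0// powRM ?powR_ge0// (powR_root p1).
Qed.

Lemma lp_mul_trunc_le (a : nat -> R) m (x : L) : (forall i, `|a i| <= 1) ->
  (forall i, (m <= i)%N -> a i = 0) -> `|lp_mul a x| <= `|lp_trunc p1 m x|.
Proof.
move=> a1 a0; apply: lp_norm_dom => i; rewrite lp_mulE// lp_truncE normrZ.
by case: ltnP => [im|/a0 ->]; rewrite ?ler_piMl// normr0 mul0r.
Qed.

Lemma wnorm_trunc_le k x : wnorm k x <= `|lp_trunc p1 (M k) x|.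
Proof.
apply: lp_mul_trunc_le; first exact: phi_root_norm.
by move=> i /phi_supp ->; rewrite powR0// invr_eq0 gt_eqF.
Qed.

Lemma wnorm_sum_le (x : L) K : \sum_(k < K) wnorm k x `^ p <= `|x| `^ p.
Proof.
(* A common bound for the supports of the first [K] weights; it allows the two sums to be exchanged
   as finite sums. *)
pose n := (\sum_(k < K) M k)%N.
have wE (k : 'I_K) : wnorm k x `^ p <= \sum_(0 <= i < n) phi k i * `|x i| `^ p.
  have s0 : 0 <= \sum_(0 <= i < n) phi k i * `|x i| `^ p.
    by apply: sumr_ge0 => i _; rewrite mulr_ge0// powR_ge0.
  rewrite -[leRHS](powR_root p1)// powR_le2 ?wnorm_ge0 ?powR_ge0//.
  apply: lp_norm_le => [|m]; first exact: powR_ge0.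
  rewrite (powR_root p1)//; under eq_bigr do rewrite wnorm_coord.
  have kn : (M k <= n)%N by rewrite /n (bigD1 k)//= leq_addr.
  have [mn|nm] := leqP m n.
    rewrite [leRHS](big_cat_nat (leq0n _) mn)/= lerDl.
    by apply: sumr_ge0 => i _; rewrite mulr_ge0// powR_ge0.
  rewrite (big_cat_nat (leq0n _) (ltnW nm))/= gerDl big_nat big1// => i /andP[ni _].
  by rewrite phi_supp ?mul0r// (leq_trans kn).
apply: le_trans (ler_sum _ (fun k _ => wE k)) _.
rewrite exchange_big/=; apply: le_trans (lp_norm_sum_le x n).
apply: ler_sum => i _; rewrite -mulr_suml ler_piMl ?powR_ge0//; exact: phi_sum.
Qed.

(** Jensen's inequality at each coordinate [i], with the weights [phi k i]. *)
Lemma lp_mul_sum_le (x : nat -> L) K :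
  `|\sum_(k < K) lp_mul (phi k) (x k)| `^ p <= \sum_(k < K) wnorm k (x k) `^ p.
Proof.
have s0 : 0 <= \sum_(k < K) wnorm k (x k) `^ p.
  by apply: sumr_ge0 => k _; exact: powR_ge0.
rewrite -[leRHS](powR_root p1)// powR_le2 ?powR_ge0//.
apply: lp_norm_le => [|n]; first exact: powR_ge0.
rewrite (powR_root p1)//.
apply: (@le_trans _ _ (\sum_(0 <= i < n) \sum_(k < K) phi k i * `|x k i| `^ p)).
  apply: ler_sum => i _; rewrite lp_val_sum.
  apply: (@le_trans _ _ ((\sum_(k < K) phi k i * `|x k i|) `^ p)).
    rewrite powR_le2 ?sumr_ge0// => [|k _]; last by rewrite mulr_ge0.
    apply: le_trans (ler_norm_sum _ _ _) _; apply: ler_sum => k _.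
    by rewrite lp_mulE ?normrZ ?ger0_norm//; exact: phi_norm.
  exact: (powR_jensen p1 (w := fun k => phi k i) (t := fun k => `|x k i|)).
rewrite exchange_big/=; apply: ler_sum => k _.
apply: le_trans (lp_norm_sum_le _ n); apply: ler_sum => i _.
by rewrite wnorm_coord.
Qed.

(** The partial sum of the [phi k] is [1] before [K] and lies between [0] and [1] elsewhere, so the
    remainder is dominated by the tail of [x]. *)
Lemma partition_cvg (x : L) (e : R) : 0 < e -> exists K0, forall K, (K0 <= K)%N ->
  `|x - \sum_(k < K) lp_mul (phi k) x| <= e.
Proof.
move=> e0; have [K0 KP] := lp_trunc_cvg x e0; exists K0 => K /KP.
apply: le_trans; apply: lp_norm_dom => i.
rewrite !lp_valB lp_truncE lp_val_sum.
have -> : \sum_(k < K) lp_mul (phi k) x i = (\sum_(k < K) phi k i) *: x i.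
  by rewrite scaler_suml; apply: eq_bigr => k _; rewrite lp_mulE//; exact: phi_norm.
case: ltnP => [/phi_sum1 ->|_].
  by rewrite scale1r !subrr.
rewrite subr0 -[X in X - _]scale1r -scalerBl normrZ ler_piMl//.
rewrite ger0_norm ?subr_ge0 ?phi_sum// gerBl; exact: sumr_ge0.
Qed.

End weighted.

Section geometric.
Context (R : realType) (p : R) (p1 : 1 <= p) (d : R).
Hypothesis d0 : 0 < d.

Definition dk k : R := d / 2 ^+ k.+1.

Lemma dk_gt0 k : 0 < dk k. Proof. by rewrite divr_gt0// exprn_gt0. Qed.

Lemma dk_le k : dk k <= d.
Proof. by rewrite ler_pdivrMr ?exprn_gt0// ler_peMr ?(ltW d0)// exprn_ege1// ler1n. Qed.

Lemma dk_sum K : \sum_(k < K) dk k <= d.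
Proof.
suff -> : \sum_(k < K) dk k = d - d / 2 ^+ K by rewrite gerBl divr_ge0 ?exprn_ge0 ?ltW.
elim: K => [|K IH]; first by rewrite big_ord0 expr0 divr1 subrr.
have K0 : (2 ^+ K : R) != 0 by rewrite expf_neq0.
by rewrite big_ord_recr/= IH /dk exprS; field.
Qed.

Local Notation l := (lp_sum (fun _ : nat => R^o) p1).

(** As [dk k / d <= 1], the [p]-th power of this ratio is at most the ratio, and the ratios sum to
    at most [1]. This element of [l_p] majorizes blockwise errors of size [dk k]. *)
Lemma dk_lp : {x : l | (forall k, x k = dk k) & `|x| <= d}.
Proof.
apply: lp_exists => [|n]; first exact: ltW.
rewrite big_mkord; apply: (@le_trans _ _ (\sum_(k < n) d `^ p * (dk k / d))).
  apply: ler_sum => k _; rewrite ger0_norm ?(ltW (dk_gt0 k))//.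
  have q01 : 0 < dk k / d <= 1 by rewrite divr_gt0 ?dk_gt0//= ler_pdivrMr// mul1r dk_le.
  have /andP[q0 q1] := q01.
  rewrite -[X in X `^ p](divfK (lt0r_neq0 d0)) powRM ?(ltW q0) ?(ltW d0)// mulrC.
  by rewrite ler_wpM2l ?powR_ge0// ge1r_powR.
rewrite -mulr_sumr -mulr_suml ler_piMr ?powR_ge0// ler_pdivrMr// mul1r.
exact: dk_sum.
Qed.

End geometric.

(** * Successive approximation *)

Section iteration.
Context (R : realType) (U : completeNormedModType R) (V : normedModType R).
Context (T : {linear U -> V}) (C K eta : R) (D : set V).
Hypothesis T_le : forall x, `|T x| <= C * `|x|.
Hypothesis K0 : 0 <= K.
Hypothesis eta01 : 0 <= eta < 1.
Hypothesis almost : forall y, D y ->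
  exists x, [/\ `|x| <= K * `|y|, `|y - T x| <= eta * `|y| & D (y - T x)].

(** The remainders decrease like [eta^n], so the corrections form an absolutely convergent series in
    the complete space [U]. The set [D] keeps the remainders where the approximation applies; it
    will be [Y], or the closure of a range. *)
Lemma almost_surj_surj y : D y -> exists2 x, T x = y & `|x| <= K / (1 - eta) * `|y|.
Proof.
move=> Dy; have /andP[eta0 eta1] := eta01.
have e1 : 0 < 1 - eta by rewrite subr_gt0.
have /choice[s sP] : forall y, exists x, D y ->
    [/\ `|x| <= K * `|y|, `|y - T x| <= eta * `|y| & D (y - T x)].
  move=> z; have [/almost[x xP]|Dz] := pselect (D z); first by exists x.
  by exists 0.
pose r := fix r n := if n is n'.+1 then r n' - T (s (r n')) else y.
have rP n : D (r n) /\ `|r n| <= eta ^+ n * `|y|.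
  elim: n => [|n [Dn IH]]; first by rewrite expr0 mul1r.
  have [_ h Dr] := sP _ Dn; split=> //; apply: le_trans h _.
  by rewrite exprS -mulrA ler_wpM2l.
pose x n := s (r n).
have xle n : `|x n| <= geometric (K * `|y|) eta n.
  have [Dn rn] := rP n; have [h _ _] := sP _ Dn; apply: le_trans h _.
  by rewrite /geometric/= -mulrA [`|y| * _]mulrC ler_wpM2l.
have eta_norm : `|eta| < 1 by rewrite ger0_norm.
have cg : series (geometric (K * `|y|) eta) @ \oo --> K * `|y| / (1 - eta).
  exact: cvg_geometric_series.
have xc : cvgn [normed series x].
  apply: (series_le_cvg _ _ xle) => [n|n|]; first exact: normr_ge0.
    by rewrite /geometric/= mulr_ge0 ?exprn_ge0 ?mulr_ge0.
  exact: cvgP cg.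
have sc := normed_cvg xc.
have Tsum n : T (series x n) = y - r n.
  elim: n => [|n IH]; first by rewrite /series/= big_geq// linear0 subrr.
  by rewrite /series/= big_nat_recr//= linearD/= [T (\sum_(_ <= _ < _) _)]IH opprB addrA addrAC.
have Tc : continuous T := bounded_linear_cont T_le.
have rc : r @ \oo --> (0 : V).
  apply/cvgrPdist_le => e e0.
  have /cvgrPdist_le/(_ _ e0) := @cvg_geometric _ `|y| _ eta_norm.
  apply: filterS => n; rewrite !sub0r !normrN; apply: le_trans.
  rewrite ger0_norm; first by rewrite /geometric/= mulrC; exact: (rP n).2.
  by rewrite /geometric/= mulr_ge0// exprn_ge0.
exists (limn (series x)).
  apply: (@cvg_unique _ (@norm_hausdorff _ V) (T \o series x @ \oo)).
    by apply: continuous_cvg; [exact: Tc|exact: sc].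
  have -> : T \o series x = fun n => y - r n by apply/funext => n; exact: Tsum.
  have : (fun n => y - r n) @ \oo --> y - 0 by apply: cvgB; [exact: cvg_cst|].
  by rewrite subr0.
apply: le_trans (lim_series_norm xc) _.
apply: (@le_trans _ _ (limn (series (geometric (K * `|y|) eta)))).
  apply: (ler_lim xc (cvgP _ cg)); apply: nearW => n.
  by apply: ler_sum => i _; exact: xle.
by rewrite (cvg_lim _ cg)//= mulrAC.
Qed.

End iteration.

(** * Subspaces *)

Section subspace_case.
Context (R : realType) (p : R) (p1 : 1 <= p) (E : nat -> completeNormedModType R).
Context (E_findim : forall n, finite_dimensional (E n)).
Local Notation L := (lp_sum E p1).
Context (Y : closedSubspace L) (d : R).
Hypothesis d0 : 0 < d.
Hypothesis d1 : d <= 1.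
Context (phi : nat -> nat -> R) (M : nat -> nat).
Hypothesis phi01 : forall k i, 0 <= phi k i <= 1.
Hypothesis phi_supp : forall k i, (M k <= i)%N -> phi k i = 0.
Hypothesis phi_sum : forall K i, \sum_(k < K) phi k i <= 1.
Hypothesis phi_sum1 : forall K i, (i < K)%N -> \sum_(k < K) phi k i = 1.
Hypothesis phi_Y : forall k y, y \in Y ->
  exists2 u, u \in Y & `|lp_mul (phi k) y - u| <= dk d k ^+ 2 * `|y|.

(** The [t] form a net of the unit ball of [Y] for [N_k], and [u] in [Y] is close to [phi_k t]; [a]
    and [b] are [u] and [t] divided by [lam], slightly more than [N_k(t)]. *)
Lemma subspace_nets : exists (a b : nat -> nat -> L) (r : nat -> nat),
  [/\ forall k i, a k i \in Y, forall k i, wnorm phi k (b k i) <= 1,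
    forall k i, `|a k i - lp_mul (phi k) (b k i)| <= dk d k &
    forall k y, y \in Y -> `|y| <= 1 -> exists i lam,
      [/\ (i < r k)%N, 0 <= lam, lam <= wnorm phi k y + dk d k *+ 2 &
        `|lp_mul (phi k) y - lam *: a k i| <= dk d k *+ 2]].
Proof.
pose B : set L := [set x | x \in Y /\ `|x| <= 1].
have /choice[t tP] : forall k, exists Nt : nat * (nat -> L), (forall i, B (Nt.2 i)) /\
    forall x, B x -> exists2 i, (i < Nt.1)%N &
      `|lp_trunc p1 (M k) (x - Nt.2 i)| <= dk d k.
  move=> k; have [||N [t tP]] := @lp_trunc_net _ _ p1 _ E_findim (M k) 1 (dk d k) B _ _ (dk_gt0 d0 k).
  - by split; rewrite ?normr0// rpred0.
  - by move=> x [].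
  by exists (N, t).
have tB k i : B ((t k).2 i) by exact: (tP k).1.
have /choice[u uP] : forall ki : nat * nat, exists u, u \in Y /\
    `|lp_mul (phi ki.1) ((t ki.1).2 ki.2) - u| <= dk d ki.1 ^+ 2.
  move=> [k i]; have [tY t1] := tB k i; have [u uY uy] := phi_Y k tY.
  by exists u; split=> //; apply: le_trans uy _; rewrite ler_piMr ?exprn_ge0 ?(ltW (dk_gt0 d0 k)).
(* The extra term keeps [lam] at least [dk d k]: dividing an error of [dk d k ^+ 2] by it leaves at
   most [dk d k]. *)
pose lam k i : R := wnorm phi k ((t k).2 i) + dk d k.
have lam0 k i : 0 < lam k i by rewrite ltr_wpDl ?wnorm_ge0 ?dk_gt0.
have dlam k i : dk d k <= lam k i by rewrite lerDr wnorm_ge0.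
exists (fun k i => (lam k i)^-1 *: u (k, i)),
  (fun k i => (lam k i)^-1 *: (t k).2 i), (fun k => (t k).1); split.
- by move=> k i; rewrite rpredZ// (uP (k, i)).1.
- move=> k i; rewrite wnormZ// ger0_norm ?invr_ge0 ?(ltW (lam0 k i))// ler_pdivrMl// mulr1.
  by rewrite lerDl ltW// dk_gt0.
- move=> k i; have phi1 := phi_norm phi01 k.
  rewrite -[_ *: (t k).2 i]addr0 lp_mulP// lp_mul0// addr0 -scalerBr.
  rewrite normrZ ger0_norm ?invr_ge0 ?(ltW (lam0 k i))// ler_pdivrMl//.
  rewrite distrC (le_trans (uP (k, i)).2)//= expr2 ler_wpM2r//.
  exact/ltW/dk_gt0.
move=> k y yY y1; have [i iN ti] := (tP k).2 y (conj yY y1).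
have phi1 := phi_norm phi01 k.
exists i, (lam k i); split=> //; first exact: ltW.
  rewrite /lam mulr2n addrA lerD2r.
  have -> : (t k).2 i = y + - (y - (t k).2 i) by rewrite opprB addrC subrK.
  apply: le_trans (wnormD phi01 _ _ _) _; rewrite lerD2l -scaleN1r wnormZ//.
  rewrite normrN1 mul1r (le_trans _ ti)//; exact: wnorm_trunc_le.
rewrite scalerA mulfV ?gt_eqF// scale1r.
have -> : lp_mul (phi k) y - u (k, i) = lp_mul (phi k) (y - (t k).2 i) +
    (lp_mul (phi k) ((t k).2 i) - u (k, i)).
  rewrite addrA; congr (_ - _); apply: lp_val_inj => j.
  by rewrite lp_valD !lp_mulE// -scalerDr lp_valB subrK.
rewrite mulr2n; apply: le_trans (ler_normD _ _) _; apply: lerD.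
  by apply: le_trans ti; apply: lp_mul_trunc_le => // j; exact: phi_supp.
apply: le_trans (uP (k, i)).2 _; rewrite expr2 ger_pMl ?dk_gt0//.
exact: le_trans (dk_le d0 k) d1.
Qed.

Context (a b : nat -> nat -> L) (r s : nat -> nat).
Hypothesis aY : forall k i, a k i \in Y.
Hypothesis b1 : forall k i, wnorm phi k (b k i) <= 1.
Hypothesis ab : forall k i, `|a k i - lp_mul (phi k) (b k i)| <= dk d k.
Hypothesis a_net : forall k y, y \in Y -> `|y| <= 1 -> exists i lam,
  [/\ (i < r k)%N, 0 <= lam, lam <= wnorm phi k y + dk d k *+ 2 &
      `|lp_mul (phi k) y - lam *: a k i| <= dk d k *+ 2].
Hypothesis rs : forall k, (r k <= s k)%N.

Local Notation W := (lp_sum (fun k => l1 R (s k).+1) p1).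

Definition block_comb (v : nat -> nat -> L) k (c : 'rV[R]_(s k).+1) : L :=
  \sum_(i < (s k).+1) c ord0 i *: v k i.

Lemma block_combP v k x (c e : 'rV[R]_(s k).+1) :
  block_comb v (x *: c + e) = x *: block_comb v c + block_comb v e.
Proof.
rewrite /block_comb scaler_sumr -big_split/=; apply: eq_bigr => i _.
by rewrite !mxE scalerDl scalerA.
Qed.

Lemma block_combY k (c : 'rV[R]_(s k).+1) : block_comb a c \in Y.
Proof. by rewrite rpred_sum// => i _; rewrite rpredZ. Qed.

Lemma block_comb_wnorm k (c : l1 R (s k).+1) : wnorm phi k (block_comb b c) <= `|c|.
Proof.
rewrite l1_normE /block_comb; elim/big_ind2: _ => [|x u y v|i _].
- by rewrite -(scale0r (0 : L)) wnormZ// normr0 mul0r.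
- by move=> xu yv; apply: le_trans (wnormD phi01 _ _ _) _; exact: lerD.
- by rewrite wnormZ// ler_piMr.
Qed.

Lemma block_comb_mul k (c : l1 R (s k).+1) :
  `|block_comb a c - lp_mul (phi k) (block_comb b c)| <= dk d k * `|c|.
Proof.
have phi1 := phi_norm phi01 k.
have -> : lp_mul (phi k) (block_comb b c) =
    \sum_(i < (s k).+1) (c : 'rV[R]__) ord0 i *: lp_mul (phi k) (b k i).
  apply: lp_val_inj => j; rewrite lp_mulE// /block_comb !lp_val_sum scaler_sumr.
  by apply: eq_bigr => i _; rewrite !lp_valZ lp_mulE// !scalerA mulrC.
rewrite -sumrB; apply: le_trans (ler_norm_sum _ _ _) _.
rewrite l1_normE mulr_sumr; apply: ler_sum => i _.
by rewrite -scalerBr normrZ mulrC ler_wpM2r.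
Qed.


Definition psum K (w : W) : L := \sum_(k < K) block_comb a (w k).

(** Replacing [a k i] by [phi_k b k i] costs at most [d |w|] in total. Jensen then applies, since
    [N_k] of a combination of the [b k i] is at most the [l_1] norm of its coefficients. *)
Lemma psum_le K (w : W) : `|psum K w| <= (1 + d) * `|w|.
Proof.
have -> : psum K w = \sum_(k < K) lp_mul (phi k) (block_comb b (w k)) +
    \sum_(k < K) (block_comb a (w k) - lp_mul (phi k) (block_comb b (w k))).
  by rewrite -big_split/=; apply: eq_bigr => k _; rewrite addrC subrK.
rewrite mulrDl mul1r; apply: le_trans (ler_normD _ _) _; apply: lerD.
  rewrite -(powR_le2 p1 (normr_ge0 _) (normr_ge0 _)).
  apply: le_trans (lp_mul_sum_le phi01 phi_sum (fun k => block_comb b (w k)) K) _.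
  apply: le_trans (lp_norm_sum_le w K); rewrite big_mkord.
  by apply: ler_sum => k _; rewrite powR_le2 ?wnorm_ge0// block_comb_wnorm.
apply: le_trans (ler_norm_sum _ _ _) _.
apply: (@le_trans _ _ (\sum_(k < K) dk d k * `|w|)); last first.
  by rewrite -mulr_suml ler_wpM2r// dk_sum.
apply: ler_sum => k _; apply: le_trans (block_comb_mul (w k)) _.
by rewrite ler_wpM2l ?(ltW (dk_gt0 d0 k))//; exact: (lp_coord_le w k).
Qed.

Lemma psumP K x (w v : W) : psum K (x *: w + v) = x *: psum K w + psum K v.
Proof.
rewrite /psum scaler_sumr -big_split/=; apply: eq_bigr => k _.
exact: block_combP.
Qed.

Lemma psum_trunc J K (w : W) : (J <= K)%N ->
  psum K (w - lp_trunc p1 J w) = psum K w - psum J w.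
Proof.
move=> JK; rewrite /psum (big_ord_widen _ (fun k => block_comb a (w k)) JK).
rewrite [X in _ = _ - X]big_mkcond/= -sumrB; apply: eq_bigr => k _.
rewrite /seq_trunc; case: ltnP => kJ; last by rewrite !subr0.
by rewrite !subrr /block_comb big1// => i _; rewrite mxE scale0r.
Qed.

Lemma psum_cvg (w : W) : cvgn (psum ^~ w).
Proof.
apply: cauchy_cvg; apply/cauchyP => e e0.
have d1' : 0 < 1 + d by rewrite addr_gt0.
have e'0 : 0 < e / 2 / (1 + d) by rewrite !divr_gt0.
have [J JP] := lp_trunc_cvg w e'0.
exists (psum J w); exists J => // K /= JK; rewrite -ball_normE/= distrC.
rewrite -psum_trunc//; apply: le_lt_trans (psum_le _ _) _.
apply: (@le_lt_trans _ _ (e / 2)); last by rewrite ltr_pdivrMr// ltr_pMr// ltr1n.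
by rewrite mulrC -ler_pdivlMr//; exact: JP.
Qed.

Lemma subspace_synthesis : exists V : {linear W -> L},
  [/\ forall w, V w \in Y, forall w, `|V w| <= (1 + d) * `|w| &
   forall y, y \in Y -> `|y| = 1 -> exists2 w, `|w| <= 1 + d *+ 2 &
     `|y - V w| <= d *+ 2].
Proof.
pose f w := limn (psum ^~ w).
have fc w : psum ^~ w @ \oo --> f w by exact: psum_cvg.
have [|V VE] := @exists_linear R W L f.
  move=> x w v; apply: (@cvg_unique _ (@norm_hausdorff _ L) (psum ^~ (x *: w + v) @ \oo)).
    exact: fc.
  have -> : psum ^~ (x *: w + v) = fun K => x *: psum K w + psum K v.
    by apply/funext => K; rewrite psumP.
  by apply: cvgD; [apply: cvgZr; exact: fc|exact: fc].
exists V; split=> [w|w|y yY y1].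
- rewrite VE; apply: (@closed_cvg _ _ _ _ (psum ^~ w) [set` csub Y] (@csub_closed _ _ Y) _ _ (fc w)).
  by apply: nearW => K /=; rewrite rpred_sum// => k _; exact: block_combY.
- rewrite VE; apply: (cvgr_to_le (cvg_norm (fc w))).
  by apply: nearW => K; exact: psum_le.
have y1' : `|y| <= 1 by rewrite y1.
have /choice[i /choice[lam ilP]] := fun k => a_net k yY y1'.
pose c k : l1 R (s k).+1 := lam k *: (delta_mx ord0 (inord (i k)) : 'rV[R]__).
have inordE k : nat_of_ord (inord (i k) : 'I_(s k).+1) = i k.
  by rewrite inordK// ltnS (leq_trans _ (rs k))// ltnW//; have [] := ilP k.
have c_norm k : `|c k| = lam k.
  rewrite l1_normE (bigD1 (inord (i k)))//= big1 ?addr0 => [|j jk].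
    by rewrite !mxE !eqxx mulr1 ger0_norm//; have [] := ilP k.
  by rewrite !mxE (negbTE jk) andbF mulr0 normr0.
have c_comb k : block_comb a (c k) = lam k *: a k (i k).
  rewrite /block_comb (bigD1 (inord (i k)))//= big1 ?addr0 => [|j jk].
    by rewrite !mxE !eqxx mulr1 inordE.
  by rewrite !mxE (negbTE jk) andbF mulr0 scale0r.
have [|x1 x1E x1le] := @lp_exists R p p1 (fun=> R^o) (fun k => wnorm phi k y) `|y| (normr_ge0 _).
  move=> n; rewrite big_mkord; apply: le_trans (wnorm_sum_le phi01 phi_supp phi_sum y n).
  by apply: ler_sum => k _; rewrite ger0_norm// wnorm_ge0.
have [x2 x2E x2le] := dk_lp p1 d0.
(* The [k]-th block has norm [lam k <= N_k(y) + 2 d_k]; these two sequences have [l_p] norms at most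
   [|y|] and [2 d]. *)
have [|w wc wle] := @lp_exists_dom R p p1 (fun k => l1 R (s k).+1) (fun=> R^o) c (x1 + x2 *+ 2).
  move=> k; rewrite c_norm mulr2n !lp_valD x1E x2E -mulr2n ger0_norm.
    by have [] := ilP k.
  by rewrite addr_ge0 ?wnorm_ge0// mulrn_wge0// ltW// dk_gt0.
exists w.
  apply: le_trans wle _; apply: le_trans (ler_normD _ _) _.
  rewrite lerD ?(le_trans x1le) ?y1// mulr2n (le_trans (ler_normD _ _))//.
  by rewrite mulr2n lerD.
rewrite VE; apply/ler_addgt0Pr => e e0; have e20 : 0 < e / 2 by rewrite divr_gt0.
have [K0 K0P] := partition_cvg phi01 phi_sum phi_sum1 y e20.
have /cvgrPdist_le/(_ _ e20) [K1 _ K1P] := fc w.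
pose K := maxn K0 K1.
have yK := K0P K (leq_maxl _ _); have wK := K1P K (leq_maxr _ _).
have sK : `|\sum_(k < K) lp_mul (phi k) y - psum K w| <= d *+ 2.
  rewrite /psum -sumrB; apply: le_trans (ler_norm_sum _ _ _) _.
  apply: (@le_trans _ _ (\sum_(k < K) dk d k *+ 2)).
    by apply: ler_sum => k _; rewrite wc c_comb; have [] := ilP k.
  by rewrite sumrMnl lerMn2r dk_sum// orbT.
have -> : y - f w = (y - \sum_(k < K) lp_mul (phi k) y) +
    (\sum_(k < K) lp_mul (phi k) y - psum K w) - (f w - psum K w).
  by rewrite addrA subrK opprB addrA subrK.
apply: le_trans (ler_normB _ _) _; rewrite (splitr e) [leRHS]addrA lerD//.
by rewrite [leRHS]addrC (le_trans (ler_normD _ _))// lerD.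
Qed.

End subspace_case.

(** * Quotients *)

Section quotient_case.
Context (R : realType) (p : R) (p1 : 1 <= p) (E : nat -> completeNormedModType R).
Context (E_findim : forall n, finite_dimensional (E n)).
Local Notation L := (lp_sum E p1).
Context (Z : closedSubspace L) (d : R).
Hypothesis d0 : 0 < d.
Hypothesis d1 : d <= 1.
Context (phi : nat -> nat -> R) (M : nat -> nat).
Hypothesis phi01 : forall k i, 0 <= phi k i <= 1.
Hypothesis phi_supp : forall k i, (M k <= i)%N -> phi k i = 0.
Hypothesis phi_sum : forall K i, \sum_(k < K) phi k i <= 1.
Hypothesis phi_sum1 : forall K i, (i < K)%N -> \sum_(k < K) phi k i = 1.
Hypothesis phi_Z : forall k z, z \in Z ->
  exists2 u, u \in Z & `|lp_mul (phi k) z - u| <= dk d k ^+ 2 * `|z|.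

Let dk0 k : 0 < dk d k. Proof. exact: dk_gt0. Qed.
Let dk00 k : 0 <= dk d k. Proof. exact/ltW. Qed.

(* The term [dk d k * |x|] controls the size of an almost optimal representative
   of a class, which [wnorm] alone does not. *)
Definition qnorm_set k x : set R :=
  [set wnorm phi k (x + z) + dk d k * `|x + z| | z in [set` csub Z]].

Definition qnorm k x : R := inf (qnorm_set k x).

Lemma qnorm_le k x z : z \in Z ->
  qnorm k x <= wnorm phi k (x + z) + dk d k * `|x + z|.
Proof.
move=> zZ; apply: ge_inf; last by exists z.
by exists 0 => _ [u _ <-]; rewrite addr_ge0 ?wnorm_ge0// mulr_ge0.
Qed.

Lemma qnorm_lt k x (e : R) : 0 < e ->
  exists2 z, z \in Z & wnorm phi k (x + z) + dk d k * `|x + z| < qnorm k x + e.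
Proof.
move=> e0; have [|_ [z zZ <-] xe] := @inf_adherent _ (qnorm_set k x) _ e0.
  split; first by exists (wnorm phi k (x + 0) + dk d k * `|x + 0|), 0 => //=; rewrite rpred0.
  by exists 0 => _ [u _ <-]; rewrite addr_ge0 ?wnorm_ge0// mulr_ge0.
by exists z.
Qed.

Lemma qnorm_sublinear k : sublinear (qnorm k).
Proof.
split=> [x y|t x t0]; apply/ler_addgt0Pr => e e0.
  have e20 : 0 < e / 2 by rewrite divr_gt0.
  have [z zZ xz] := qnorm_lt k x e20; have [u uZ yu] := qnorm_lt k y e20.
  have zuZ : z + u \in Z by rewrite rpredD.
  apply: le_trans (qnorm_le k (x + y) zuZ) _; rewrite addrACA.
  have dxy : dk d k * `|x + z + (y + u)| <= dk d k * `|x + z| + dk d k * `|y + u|.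
    by rewrite -mulrDr; apply: ler_wpM2l => //; exact: ler_normD.
  apply: le_trans (lerD (wnormD phi01 k (x + z) (y + u)) dxy) _.
  rewrite addrACA; apply: le_trans (lerD (ltW xz) (ltW yu)) _.
  by rewrite addrACA -splitr.
have e't : 0 < e / (t + 1) by rewrite divr_gt0// ltr_wpDl.
have [z zZ xz] := qnorm_lt k x e't.
have tzZ : t *: z \in Z by rewrite rpredZ.
apply: le_trans (qnorm_le k (t *: x) tzZ) _; rewrite -scalerDr wnormZ// normrZ.
rewrite ger0_norm// mulrCA -mulrDr.
apply: le_trans (ler_wpM2l t0 (ltW xz)) _; rewrite mulrDr lerD2l.
by rewrite mulrCA ger_pMr// ler_pdivrMr ?mul1r ?lerDl// ltr_wpDl.
Qed.

Lemma qnorm_opp k x : qnorm k (- x) <= qnorm k x.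
Proof.
apply/ler_addgt0Pr => e e0; have [z zZ xz] := qnorm_lt k x e0.
have zNZ : - z \in Z by rewrite rpredN.
apply: le_trans (qnorm_le k (- x) zNZ) _; rewrite -opprD normrN -scaleN1r wnormZ//.
by rewrite normrN1 mul1r ltW.
Qed.

(** [f k i] is a Hahn-Banach functional below [q_k] that attains [q_k] at the [i]-th net point; it
    vanishes on [Z] because [q_k] does. The radius is [2] because a quotient norm need not be
    attained. *)
Lemma quotient_nets : exists (f : nat -> nat -> L -> R) (r : nat -> nat),
  [/\ forall k i c x y, f k i (c *: x + y) = c * f k i x + f k i y,
    forall k i x, `|f k i x| <= wnorm phi k x + dk d k * `|x|,
    forall k i z, z \in Z -> f k i z = 0 &
    forall k x, `|x| <= 2 -> exists i z, [/\ (i < r k)%N, z \in Z &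
      wnorm phi k (x + z) + dk d k * `|x + z| <= `|f k i x| + dk d k *+ 11]].
Proof.
(* With [a = d_k] and [w] the net point, [q_k(x - w) <= 5 a] is paid twice, to pass from [x] to [w]
   and back, and [z] is optimal up to [a]: hence [11 a]. *)
have arith (a qx qxw qw fw fx nfx : R) : qxw <= a + a * (2 + 2) -> fw = qw ->
    qx <= qxw + qw -> fw <= fx + qxw -> fx <= nfx -> qx + a <= nfx + a *+ 11.
  by rewrite -[a *+ 11]mulr_natl; lra.
pose B : set L := [set x | `|x| <= 2].
have /choice[t tP] : forall k, exists Nt : nat * (nat -> L), (forall i, B (Nt.2 i)) /\
    forall x, B x -> exists2 i, (i < Nt.1)%N &
      `|lp_trunc p1 (M k) (x - Nt.2 i)| <= dk d k.
  move=> k; have [||N [t tP]] := @lp_trunc_net _ _ p1 _ E_findim (M k) 2 (dk d k) B _ _ (dk0 k).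
  - by rewrite /B/= normr0.
  - by [].
  by exists (N, t).
have /choice[f fP] : forall ki : nat * nat, exists f : L -> R,
    [/\ forall a x y, f (a *: x + y) = a * f x + f y,
    forall x, f x <= qnorm ki.1 x & f ((t ki.1).2 ki.2) = qnorm ki.1 ((t ki.1).2 ki.2)].
  by move=> [k i]; exact: hahn_banach_sublinear (qnorm_sublinear k).
have fL k i c x y : f (k, i) (c *: x + y) = c * f (k, i) x + f (k, i) y.
  by have [+ _ _] := fP (k, i); apply.
have fq k i x : f (k, i) x <= qnorm k x by have [_ + _] := fP (k, i); apply.
have f0 k i : f (k, i) 0 = 0.
  have := fL k i 1 0 0; rewrite scale1r addr0 mul1r => ff.
  by apply: (addrI (f (k, i) 0)); rewrite addr0 -ff.
have fN k i x : f (k, i) (- x) = - f (k, i) x.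
  by rewrite -[- x]addr0 -scaleN1r fL f0 mulN1r addr0.
have fqN k i x : `|f (k, i) x| <= qnorm k x.
  rewrite ler_norml fq andbT lerNl -fN; apply: le_trans (fq k i _) _.
  exact: qnorm_opp.
exists (fun k i => f (k, i)), (fun k => (t k).1); split.
- by move=> k i c x y; exact: fL.
- move=> k i x; apply: le_trans (fqN k i x) _.
  by have := qnorm_le k x (rpred0 Z); rewrite addr0.
- move=> k i z zZ; apply/eqP; rewrite -normr_le0; apply: le_trans (fqN k i z) _.
  have zNZ : - z \in Z by rewrite rpredN.
  have := qnorm_le k z zNZ; rewrite subrr normr0 mulr0 addr0.
  by rewrite -(scale0r (0 : L)) wnormZ// normr0 mul0r.
move=> k x x2; have [i iN ti] := (tP k).2 x x2.
have [z zZ xz] := qnorm_lt k x (dk0 k).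
exists i, z; split=> //; apply: le_trans (ltW xz) _.
set w := (t k).2 i in ti *; have w2 : `|w| <= 2 by exact: (tP k).1.
have dxw : dk d k * `|x - w| <= dk d k * (2 + 2).
  apply: ler_wpM2l => //; apply: le_trans (ler_normB _ _) _; exact: lerD.
have qxw : qnorm k (x - w) <= dk d k + dk d k * (2 + 2).
  apply: le_trans (qnorm_le k (x - w) (rpred0 Z)) _; rewrite addr0.
  apply: lerD dxw; apply: le_trans ti.
  exact: wnorm_trunc_le phi01 phi_supp k (x - w).
have fw : f (k, i) w = qnorm k w by have [] := fP (k, i).
have qx : qnorm k x <= qnorm k (x - w) + qnorm k w.
  by have := (qnorm_sublinear k).1 (x - w) w; rewrite subrK.
have fwx : f (k, i) w <= f (k, i) x + qnorm k (x - w).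
  have wE : w = 1 *: x + - (x - w) by rewrite scale1r opprB addrC subrK.
  rewrite [in leLHS]wE fL mul1r lerD2l; apply: le_trans (fq _ _ _) _.
  exact: qnorm_opp.
exact: arith qxw fw qx fwx (ler_norm _).
Qed.

Context (f : nat -> nat -> L -> R) (r s : nat -> nat).
Hypothesis f_lin : forall k i c x y, f k i (c *: x + y) = c * f k i x + f k i y.
Hypothesis f_le : forall k i x, `|f k i x| <= wnorm phi k x + dk d k * `|x|.
Hypothesis f_ker : forall k i z, z \in Z -> f k i z = 0.
Hypothesis f_net : forall k x, `|x| <= 2 -> exists i z, [/\ (i < r k)%N, z \in Z &
  wnorm phi k (x + z) + dk d k * `|x + z| <= `|f k i x| + dk d k *+ 11].
Hypothesis rs : forall k, (r k <= s k)%N.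

Local Notation W := (lp_sum (fun k => 'rV[R]_(s k).+1) p1).
Local Notation l := (lp_sum (fun _ : nat => R^o) p1).

(** [U x] lists the values [f k i x]. For the lift, [z k] in [Z] makes [x + z k] nearly optimal for
    [q_k]; these are glued into the sum of the [v k], with [v k] in [Z] close to [phi_k z k], and
    Jensen bounds the sum of the [phi_k (x + z k)]. *)
Lemma quotient_analysis : exists U : {linear L -> W},
  [/\ forall x, `|U x| <= (1 + d) * `|x|, forall z, z \in Z -> U z = 0 &
    forall x, `|x| <= 2 -> exists2 z, z \in Z & `|x + z| <= `|U x| + d *+ 42].
Proof.
have arith (a nx u xz : R) : 0 <= a -> a <= 1 -> nx <= 2 -> u <= (1 + d) * 2 ->
    a * xz <= u + a *+ 11 -> a * xz + a * nx <= 30.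
  by rewrite -[a *+ 11]mulr_natl => a0 a1 nx2 u2 axz; have := d1; nra.
have arith2 (A B C u : R) : A <= d -> B <= u + d *+ 11 -> C <= d *+ 30 ->
    A + B + C <= u + d *+ 42.
  by rewrite -[d *+ 11]mulr_natl -[d *+ 30]mulr_natl -[d *+ 42]mulr_natl; lra.
have [dl dlE dl_le] := dk_lp p1 d0.
pose F x k : 'rV[R]_(s k).+1 := \row_i f k i x.
have /choice[u uP] : forall x : L, exists w : W,
    (forall k, w k = F x k) /\ `|w| <= (1 + d) * `|x|.
  move=> x.
  have [|x1 x1E x1le] := @lp_exists R p p1 (fun=> R^o) (fun k => wnorm phi k x) `|x| (normr_ge0 _).
    move=> n; rewrite big_mkord; apply: le_trans (wnorm_sum_le phi01 phi_supp phi_sum x n).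
    by apply: ler_sum => k _; rewrite ger0_norm// wnorm_ge0.
  have [|w wE wle] := @lp_exists_dom R p p1 (fun k => 'rV[R]_(s k).+1) (fun=> R^o) (F x) (x1 + `|x| *: dl).
    move=> k; rewrite lp_valD lp_valZ x1E dlE [`|x| *: _]mulrC.
    have b0 : 0 <= wnorm phi k x + dk d k * `|x| by rewrite addr_ge0 ?wnorm_ge0// mulr_ge0.
    by rewrite [leRHS]ger0_norm//; apply: mx_norm_le => // i; rewrite mxE.
  exists w; split=> //; apply: le_trans wle _; apply: le_trans (ler_normD _ _) _.
  by rewrite mulrDl mul1r lerD// normrZ normr_id mulrC ler_wpM2r.
have [|U UE] := @exists_linear R L W u.
  move=> a x y; apply: lp_val_inj => k; rewrite lp_valD lp_valZ.
  rewrite (uP _).1 (uP x).1 (uP y).1.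
  by apply/rowP => i; rewrite !mxE f_lin.
have Uk x k : U x k = F x k by rewrite UE (uP x).1.
exists U; split=> [x|z zZ|x x2].
- by rewrite UE; exact: (uP x).2.
- apply: lp_val_inj => k; rewrite Uk; apply/rowP => i.
  by rewrite !mxE f_ker.
have U4 : `|U x| <= (1 + d) * 2.
  rewrite UE; apply: le_trans (uP x).2 _; apply: ler_wpM2l => //.
  by rewrite addr_ge0 ?ltW.
have /choice[z zP] : forall k, exists z, z \in Z /\
    wnorm phi k (x + z) + dk d k * `|x + z| <= `|U x k| + dk d k *+ 11.
  move=> k; have [i [z [ir zZ xz]]] := f_net k x2; exists z; split=> //.
  apply: le_trans xz _; rewrite lerD2r Uk.
  have i_s : (i < (s k).+1)%N by rewrite ltnS (leq_trans _ (rs k))// ltnW.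
  by have := mx_coord_le (F x k) (Ordinal i_s); rewrite mxE.
have /choice[v vP] : forall k, exists v, v \in Z /\
    `|lp_mul (phi k) (z k) - v| <= dk d k *+ 30.
  move=> k; have [zZ xz] := zP k; have [v vZ zv] := phi_Z k zZ.
  exists v; split=> //; apply: le_trans zv _.
  (* [d_k |z k|] is at most [d_k |x + z k| + d_k |x| <= (4 + 11) + 2], rounded up; the other factor
     of [d_k^2] remains in the error. *)
  have dz : dk d k * `|z k| <= 30.
    have -> : z k = (x + z k) - x by rewrite addrC addKr.
    apply: le_trans (ler_wpM2l (dk00 k) (ler_normB _ _)) _.
    rewrite mulrDr; apply: (arith _ _ _ _ (dk00 k) (le_trans (dk_le d0 k) d1) x2
      (le_trans (lp_coord_le (U x) k) U4)).
    by apply: le_trans _ (zP k).2; rewrite lerDr wnorm_ge0.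
  by rewrite expr2 -mulrA -mulr_natr ler_wpM2l.
have e0 : 0 < d by [].
have [K KP] := partition_cvg phi01 phi_sum phi_sum1 x e0.
have {KP} xK := KP K (leqnn K).
exists (\sum_(k < K) v k); first by rewrite rpred_sum// => k _; exact: (vP k).1.
(* The three terms have norms at most [d], [|U x| + 11 d] and [30 d], whence the constant [42]. *)
have -> : x + \sum_(k < K) v k = (x - \sum_(k < K) lp_mul (phi k) x) +
    (\sum_(k < K) lp_mul (phi k) (x + z k)) -
    \sum_(k < K) (lp_mul (phi k) (z k) - v k).
  have -> : \sum_(k < K) lp_mul (phi k) (x + z k) =
      \sum_(k < K) lp_mul (phi k) x + \sum_(k < K) lp_mul (phi k) (z k).
    rewrite -big_split/=; apply: eq_bigr => k _.
    by rewrite -[x in x + _]scale1r lp_mulP ?scale1r//; exact: phi_norm.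
  by rewrite addrA subrK sumrB opprB -[RHS]addrA [X in _ = _ + X]addrC subrK.
have sv : `|\sum_(k < K) (lp_mul (phi k) (z k) - v k)| <= d *+ 30.
  apply: le_trans (ler_norm_sum _ _ _) _.
  apply: (@le_trans _ _ (\sum_(k < K) dk d k *+ 30)).
    by apply: ler_sum => k _; exact: (vP k).2.
  by rewrite sumrMnl lerMn2r dk_sum.
have sz : `|\sum_(k < K) lp_mul (phi k) (x + z k)| <= `|U x| + d *+ 11.
  have [|g gE gle] := @lp_exists_dom R p p1 (fun=> R^o) (fun k => 'rV[R]_(s k).+1) (fun k => `|U x k|) (U x).
    by move=> k; rewrite normr_id.
  apply: (@le_trans _ _ `|g + dl *+ 11|); last first.
    apply: le_trans (ler_normD _ _) _; apply: lerD => //.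
    by rewrite -[dl *+ 11]scaler_nat normrZ normr_nat -[d *+ 11]mulr_natl ler_wpM2l.
  rewrite -(powR_le2 p1 (normr_ge0 _) (normr_ge0 _)).
  apply: le_trans (lp_mul_sum_le phi01 phi_sum (fun k => x + z k) K) _.
  apply: le_trans (lp_norm_sum_le (g + dl *+ 11) K); rewrite big_mkord.
  apply: ler_sum => k _; rewrite powR_le2 ?wnorm_ge0//.
  rewrite -[dl *+ 11]scaler_nat lp_valD lp_valZ gE dlE.
  apply: le_trans _ (ler_norm _); rewrite [_ *: _]mulr_natl.
  apply: le_trans (zP k).2; rewrite lerDl mulr_ge0//.
apply: le_trans (arith2 _ _ _ _ xK sz sv).
by apply: le_trans (ler_normB _ _) _; rewrite lerD2r; exact: ler_normD.
Qed.

End quotient_case.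

(** * Conclusion *)

Section quotient_range.
Context (R : realType) (V : normedModType R) (T : {linear V -> V}).
Context (Z Y : closedSubspace V) (C K : R).
Hypothesis C0 : 0 <= C.
Hypothesis K0 : 0 <= K.
Hypothesis TZ : forall x, T x = 0 <-> x \in Z.
Hypothesis TY : forall x, T x \in Y.
Hypothesis T_le : forall x, `|T x| <= C * `|x|.
Hypothesis lift : forall y, y \in Y -> exists2 x, T x = y & `|x| <= K * `|y|.

Lemma quotient_pi_linear a x y :
  quotient_pi Z (a *: x + y) = a *: quotient_pi Z x + quotient_pi Z y.
Proof. by rewrite quotient_piD [a *: quotient_pi Z x]quotient_scale_pi. Qed.

(** [A] is induced by [T] on the quotient by its kernel. [B] sends [y] to the class of a chosen
    preimage; it is linear although the choice is not, because the class of [x] depends on [T x]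
    alone. *)
Lemma quotient_range_iso : exists (A : {linear quotient_by Z -> subspace_of Y})
    (B : {linear subspace_of Y -> quotient_by Z}),
  [/\ cancel A B, cancel B A, forall q, `|A q| <= C * `|q|
    & forall y, `|B y| <= K * `|y|].
Proof.
have /choice[h hP] := @quotient_pi_surj R V Z.
have ThE x : T (h (quotient_pi Z x)) = T x.
  have /quotient_piP/TZ := hP (quotient_pi Z x).
  by rewrite linearB/= => /eqP; rewrite subr_eq0 => /eqP.
have /choice[g gP] : forall y : subspace_of Y, exists x,
    T x = val y /\ `|x| <= K * `|y|.
  by move=> [y yY]; have [x xy xK] := lift yY; exists x.
pose A0 (q : quotient_by Z) : subspace_of Y := exist _ (T (h q)) (TY (h q)).
pose B0 (y : subspace_of Y) : quotient_by Z := quotient_pi Z (g y).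
have piT x y : T x = T y -> quotient_pi Z x = quotient_pi Z y.
  by move=> xy; apply/quotient_piP/TZ; rewrite linearB/= xy subrr.
have [|A AE] := @exists_linear R _ _ A0.
  move=> a q r; apply: val_inj; rewrite linearP/=.
  have [x <-] := quotient_pi_surj q; have [y <-] := quotient_pi_surj r.
  by rewrite -quotient_pi_linear !ThE linearP.
have [|B BE] := @exists_linear R _ _ B0.
  move=> a y z; rewrite /B0 -quotient_pi_linear; apply: piT.
  by rewrite linearP/= !(gP _).1 linearP.
exists A, B; split=> [q|y|q|y].
- rewrite AE BE /B0 -[RHS](hP q); apply: piT.
  by rewrite (gP _).1.
- by rewrite AE BE; apply: val_inj; rewrite /= /B0 ThE (gP y).1.
- rewrite AE; have [C00|C00] := eqVneq C 0.
    by have := T_le (h q); rewrite C00 !mul0r.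
  have {}C00 : 0 < C by rewrite lt_def C00.
  apply/ler_addgt0Pr => e e0; have [x xq xe] := quotient_norm_lt q (divr_gt0 e0 C00).
  have -> : `|A0 q| = `|T x| by rewrite -(ThE x) xq.
  apply: le_trans (T_le x) _; apply: le_trans (ler_wpM2l C0 (ltW xe)) _.
  by rewrite mulrDr mulrCA divff ?gt_eqF// mulr1.
- by rewrite BE; apply: le_trans (quotient_norm_le _ _) (gP y).2.
Qed.

Lemma BMdist_quotient_range : (BMdist (quotient_by Z) (subspace_of Y) <= (C * K)%:E)%E.
Proof.
have [A [B [AB BA A_le B_le]]] := quotient_range_iso.
exact: BMdist_le AB BA C0 K0 A_le B_le.
Qed.

Lemma BMdist_range_quotient : (BMdist (subspace_of Y) (quotient_by Z) <= (C * K)%:E)%E.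
Proof.
have [A [B [AB BA A_le B_le]]] := quotient_range_iso.
by rewrite mulrC; exact: BMdist_le BA AB K0 C0 B_le A_le.
Qed.

End quotient_range.

Section kernel_range.
Context (R : realType) (V : normedModType R) (T : {linear V -> V}).

Lemma closedSubspace_ker (C : R) : (forall x, `|T x| <= C * `|x|) ->
  exists Z : closedSubspace V, forall x, T x = 0 <-> x \in Z.
Proof.
move=> TC; pose P : {pred V} := [pred x | T x == 0].
have Pm : submod_closed P.
  split; first by rewrite inE linear0.
  by move=> a x y; rewrite !inE linearP => /eqP -> /eqP ->; rewrite scaler0 addr0.
have Pc : closed [set` P].
  have -> : [set` P] = T @^-1` [set 0] by apply/seteqP; split=> x /= /eqP.
  apply: closed_comp => [x _|]; first exact: bounded_linear_cont TC x.
  by apply: accessible_closed_set1; apply: hausdorff_accessible; exact: norm_hausdorff.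
by exists (ClosedSubspace Pm Pc) => x; split=> [/eqP|/eqP].
Qed.

Lemma closedSubspace_range : (forall y, (forall e, 0 < e -> exists x, `|y - T x| <= e) ->
    exists x, T x = y) ->
  exists Y : closedSubspace V, forall y, y \in Y <-> exists x, T x = y.
Proof.
move=> Tcl; pose P : {pred V} := [pred y | `[< exists x, T x = y >]].
have PE y : y \in P <-> exists x, T x = y by split=> /asboolP.
have Pm : submod_closed P.
  split; first by apply/PE; exists 0; rewrite linear0.
  by move=> a x y /PE[u <-] /PE[v <-]; apply/PE; exists (a *: u + v); rewrite linearP.
have Pc : closed [set` P].
  move=> y yP; apply/PE/Tcl => e e0.
  have [|_ [/PE[x <-]]] := yP (ball y e); first exact: nbhsx_ballx.
  by rewrite -ball_normE => /ltW yx; exists x.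
by exists (ClosedSubspace Pm Pc).
Qed.

End kernel_range.

Section main.
Context (R : realType) (E : nat -> completeNormedModType R).
Context (E_findim : forall n, finite_dimensional (E n)) (E_dense : BMdense E).
Context (p : R) (p_gt1 : 1 < p).
Let p1 := ltW p_gt1.
Local Notation L := (lp_sum E p1).

(** [T] is [V \o Psi]. For a unit vector of [Y], [Phi w] is almost a preimage because
    [Psi (Phi w) = w], with norm at most [(1 + d) (1 + 2 d)]; successive approximation with ratio
    [2 d] makes it exact. *)
Lemma subspace_as_range (Y : closedSubspace L) (d : R) : 0 < d -> d *+ 2 < 1 ->
  exists T : {linear L -> L}, [/\ forall x, T x \in Y,
    forall x, `|T x| <= (1 + d) * `|x| &
    forall y, y \in Y -> exists2 x, T x = y &
      `|x| <= (1 + d) * (1 + d *+ 2) / (1 - d *+ 2) * `|y|].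
Proof.
move=> d0 d21; have d1 : d <= 1 by move: d21; rewrite mulr2n; lra.
have eta0 k : 0 < dk d k ^+ 2 by rewrite exprn_gt0// dk_gt0.
have [phi [M [phi01 phi_supp phi_sum phi_sum1 phi_Y]]] := cutoff_partition E_findim Y p_gt1 eta0.
have [a [b [r [aY b1 ab a_net]]]] :=
  subspace_nets E_findim d0 d1 phi01 phi_supp phi_Y.
have [||s [rs [Phi [Psi [PhiK Phi_le Psi_le]]]]] :=
  @lp_factor_dense R p p1 E (fun n => l1 R n.+1) E_findim E_dense
    (fun n => @l1_basis R n.+1) _ _ d r d0.
- by move=> n v; exists v; rewrite l1_lincomb.
- by move=> n c; rewrite l1_lincomb.
have [V [VY V_le V_surj]] := subspace_synthesis d0 phi01 phi_supp phi_sum phi_sum1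
  aY b1 ab a_net rs.
pose T : {linear L -> L} := V \o Psi.
have T_le x : `|T x| <= (1 + d) * `|x|.
  by apply: le_trans (V_le _) _; rewrite ler_pM2l ?addr_gt0.
exists T; split=> [x|//|]; first exact: VY.
have c0 : 0 <= (1 + d) * (1 + d *+ 2) by rewrite mulr_ge0 ?addr_ge0 ?mulrn_wge0 ?ltW.
apply: (almost_surj_surj (D := [set` csub Y]) T_le c0) => [|y yY].
  by rewrite mulrn_wge0 ?ltW.
have [y0|y0] := eqVneq y 0.
  by exists 0; rewrite y0 linear0 subr0 !normr0 !mulr0; split=> //=; rewrite rpred0.
have ny : 0 < `|y| by rewrite normr_gt0.
have y'Y : `|y|^-1 *: y \in Y by rewrite rpredZ.
have [|w w_le yw] := V_surj _ y'Y.
  by rewrite normrZ normfV normr_id mulVf// gt_eqF.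
exists (`|y| *: Phi w); split.
- rewrite normrZ normr_id mulrC ler_pM2r//; apply: le_trans (Phi_le w) _.
  by rewrite ler_pM2l ?addr_gt0.
- have -> : y - T (`|y| *: Phi w) = `|y| *: (`|y|^-1 *: y - V w).
    by rewrite scalerBr scalerKV ?gt_eqF// linearZ/= PhiK.
  by rewrite normrZ normr_id mulrC ler_pM2r.
- by rewrite /= rpredB//; exact: VY.
Qed.

(** [T] is [Phi \o U], and [|U x| <= |T x|] since the left inverse [Psi] of [Phi] is a contraction.
    Bounding the quotient norm of the class of [x] by [|T x|] gives both the lift and the inclusion
    of the kernel in [Z]. *)
Lemma quotient_as_range (Z : closedSubspace L) (d : R) : 0 < d -> d *+ 42 < 1 ->
  exists T : {linear L -> L}, [/\ forall x, T x = 0 <-> x \in Z,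
    forall x, `|T x| <= (1 + d) ^+ 2 * `|x| &
    forall x, exists2 x', T x' = T x & `|x'| <= (1 + d) / (1 - d *+ 42) * `|T x|].
Proof.
move=> d0 d42; have d1 : d <= 1 by move: d42; rewrite -mulr_natl; lra.
have eta0 k : 0 < dk d k ^+ 2 by rewrite exprn_gt0// dk_gt0.
have [phi [M [phi01 phi_supp phi_sum phi_sum1 phi_Z]]] := cutoff_partition E_findim Z p_gt1 eta0.
have [f [r [f_lin f_le f_ker f_net]]] :=
  quotient_nets E_findim Z d0 phi01 phi_supp.
have [||s [rs [Phi [Psi [PhiK Phi_le Psi_le]]]]] :=
  @lp_factor_dense R p p1 E (fun n => 'rV[R]_n.+1) E_findim E_dense
    (fun n i => delta_mx ord0 i) _ _ d r d0.
- by move=> n v; exists v; rewrite rV_lincomb.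
- by move=> n c; rewrite rV_lincomb.
have [U [U_le U_ker U_lift]] := quotient_analysis d0 d1 phi01 phi_supp phi_sum phi_sum1
  phi_Z f_lin f_le f_ker f_net rs.
have [T TE] : exists T : {linear L -> L}, forall x, T x = Phi (U x).
  by exists (Phi \o U).
have UT x : `|U x| <= `|T x| by rewrite TE -[X in `|X| <= _]PhiK; exact: Psi_le.
have T_ker z : z \in Z -> T z = 0 by move=> /U_ker Uz; rewrite TE Uz linear0.
have T_lift x : exists2 z, z \in Z & `|x + z| <= (1 + d) / (1 - d *+ 42) * `|T x|.
  have e42 : 0 < 1 - d *+ 42 by rewrite subr_gt0.
  have K0 : 0 <= (1 + d) / (1 - d *+ 42).
    by rewrite divr_ge0 ?(ltW e42)// addr_ge0 ?ltW.
  have [/(quotient_norm_eq0 (Y := Z)) t0|t0] := eqVneq (quotient_norm (quotient_pi Z x)) 0.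
    exists (- x); last by rewrite subrr normr0 mulr_ge0.
    rewrite rpredN -[x]subr0; apply/quotient_piP; rewrite t0; apply/esym; exact: raddf0.
  set t := quotient_norm _ in t0.
  have {}t0 : 0 < t by rewrite lt_def t0 quotient_norm_ge0.
  have t_le y : y - x \in Z -> t <= `|y|.
    by move=> /quotient_piP yx; rewrite /t -yx; exact: quotient_norm_le.
  have t_lt e : 0 < e -> exists2 y, y - x \in Z & `|y| < t + e.
    by move=> e0; have [y /quotient_piP yx ye] := quotient_norm_lt (quotient_pi Z x) e0; exists y.
  (* A representative of norm below [2 t], divided by [t], falls in the ball of [U_lift]; scaling
     back gives [t <= |T x| + 42 d t]. *)
  have Tt : (1 - d *+ 42) * t <= `|T x|.
    have [y yx y_lt] := t_lt _ t0.
    have Tyx : T y = T x by apply/eqP; rewrite -subr_eq0 -linearB/= T_ker.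
    have [|z zZ yz] := U_lift (t^-1 *: y).
      rewrite normrZ gtr0_norm ?invr_gt0// ler_pdivrMl//; apply: le_trans (ltW y_lt) _.
      by rewrite mulr_natr mulr2n.
    have : t <= `|y + t *: z|.
      by apply: t_le; rewrite addrAC rpredD// rpredZ.
    have -> : y + t *: z = t *: (t^-1 *: y + z) by rewrite scalerDr scalerKV ?gt_eqF.
    rewrite normrZ gtr0_norm// => tz.
    have U1 : `|U (t^-1 *: y)| <= t^-1 * `|T x|.
      by apply: le_trans (UT _) _; rewrite linearZ normrZ Tyx ger0_norm ?lexx// invr_ge0 ltW.
    have : t * `|t^-1 *: y + z| <= t * (t^-1 * `|T x| + d *+ 42).
      by rewrite ler_pM2l// (le_trans yz)// lerD2r.
    rewrite mulrDr mulrA divff ?gt_eqF// mul1r => /(le_trans tz).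
    by rewrite mulrBl mul1r lerBlDr [d *+ 42 * t]mulrC.
  have [y yx y_lt] := t_lt _ (mulr_gt0 d0 t0).
  exists (y - x) => //; rewrite addrC subrK; apply: le_trans (ltW y_lt) _.
  rewrite mulrAC ler_pdivlMr// -[X in X + _]mul1r -mulrDl -mulrA.
  by rewrite ler_pM2l ?addr_gt0// mulrC.
exists T; split=> [x|x|x].
- split=> [Tx|/T_ker//]; have [z zZ] := T_lift x.
  rewrite Tx normr0 mulr0 normr_le0 addr_eq0 => /eqP ->.
  by rewrite rpredN.
- rewrite TE; apply: le_trans (Phi_le _) _; rewrite expr2 -mulrA ler_pM2l ?addr_gt0//.
- have [z zZ xz] := T_lift x; exists (x + z) => //.
  by rewrite linearD/= (T_ker _ zZ) addr0.
Qed.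

End main.

Theorem corollary4p4 (R : realType) (E : nat -> completeNormedModType R)
    (E_findim : forall n, finite_dimensional (E n)) (E_dense : BMdense E)
    (p : R) (p1 : 1 < p) (eps : R) (eps0 : 0 < eps) :
  let C := lp_sum E (ltW p1) in
  (forall Z : closedSubspace C, exists Y : closedSubspace C,
     (BMdist (quotient_by Z) (subspace_of Y) < (1 + eps)%:E)%E) /\
  (forall Y : closedSubspace C, exists Z : closedSubspace C,
     (BMdist (subspace_of Y) (quotient_by Z) < (1 + eps)%:E)%E).
Proof.
have arith (a : R) : 0 <= a -> a + 2^-1 * a <= 2 * a by lra.
(* Capping [eps] at [1] makes [d] at most [1 / 100], so that higher powers of [d] are absorbed by
   linear terms. *)
move=> C; pose h := Order.min eps 1.
have h0 : 0 < h by rewrite lt_min eps0 ltr01.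
have [h1 he] : h <= 1 /\ h <= eps by split; rewrite ge_min lexx ?orbT.
pose d := h / 100; have d0 : 0 < d by rewrite divr_gt0.
have dh : h = 100 * d by rewrite /d mulrC divfK.
split=> [Z|Y].
  have d42 : d *+ 42 < 1 by rewrite -mulr_natl; lra.
  have [T [TZ T_le T_lift]] := quotient_as_range E_findim E_dense Z d0 d42.
  set K := (1 + d) / (1 - d *+ 42) in T_lift.
  have K0 : 0 <= K by rewrite divr_ge0 ?subr_ge0 ?addr_ge0 ?ltW.
  (* The range is closed by successive approximation with ratio [1 / 2] on its closure [D]: a
     remainder [z] is within [|z| / 2] of some [T x] of norm at most [2 |z|], and [T_lift] gives a
     preimage of [T x] of norm at most [2 K |z|]. *)
  have [y H|Y YE] := @closedSubspace_range R C T.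
    pose D : set C := [set y | forall e, 0 < e -> exists x, `|y - T x| <= e].
    have eta01 : 0 <= (2^-1 : R) < 1 by lra.
    have K20 : 0 <= 2 * K by rewrite mulr_ge0.
    have [|x Tx _] := @almost_surj_surj R C C T _ _ _ D T_le K20 eta01 _ y H.
      move=> z Dz; have [z0|z0] := eqVneq z 0.
        exists 0; rewrite linear0 subr0; split; [| |exact: Dz].
          by rewrite z0 !normr0 mulr0.
        by rewrite z0 !normr0 mulr0.
      have e0 : 0 < 2^-1 * `|z| by rewrite mulr_gt0 ?invr_gt0 ?normr_gt0.
      have [x zx] := Dz _ e0; have [x' Tx' x'le] := T_lift x.
      have Tx2 : `|T x| <= 2 * `|z|.
        have -> : T x = z - (z - T x) by rewrite opprB addrC subrK.
        apply: le_trans (ler_normB _ _) _; apply: le_trans (lerD (lexx _) zx) _.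
        exact: arith.
      exists x'; rewrite Tx'; split; [|exact: zx|].
        apply: le_trans x'le _; rewrite [2 * K]mulrC -[K * 2 * _]mulrA.
        exact: ler_wpM2l Tx2.
      move=> e e1; have [u zu] := Dz e e1; exists (u - x).
      by rewrite linearB/= opprB addrA subrK.
    by exists x.
  exists Y; apply: (@le_lt_trans _ _ ((1 + d) ^+ 2 * K)%:E).
    apply: (BMdist_quotient_range (T := T)) => //.
    - by rewrite exprn_ge0// addr_ge0 ?ltW.
    - by move=> x; apply/YE; exists x.
    - by move=> y /YE[x <-]; exact: T_lift.
  (* [(1 + d)^3 <= 1 + 7 d < (1 + 100 d) (1 - 42 d)], the last step because [0 < d <= 1 / 100]. *)
  rewrite lte_fin /K mulrA ltr_pdivrMr ?subr_gt0// -mulr_natl.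
  have : (1 + d) ^+ 2 * (1 + d) <= 1 + 7 * d by rewrite expr2; nra.
  have : 1 + 7 * d < (1 + h) * (1 - 42 * d) by rewrite dh; nra.
  have : (1 + h) * (1 - 42 * d) <= (1 + eps) * (1 - 42 * d).
    by rewrite ler_wpM2r ?lerD2l//; lra.
  by lra.
have d2 : d *+ 2 < 1 by rewrite -mulr_natl; lra.
have [T [TY T_le T_surj]] := subspace_as_range E_findim E_dense Y d0 d2.
have [Z TZ] := closedSubspace_ker T_le.
exists Z; apply: le_lt_trans (BMdist_range_quotient _ _ TZ TY T_le T_surj) _.
- by rewrite addr_ge0 ?ltW.
- rewrite divr_ge0 ?subr_ge0 ?(ltW d2)//.
  by rewrite mulr_ge0 ?addr_ge0 ?mulrn_wge0 ?(ltW d0).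
(* Likewise [(1 + d)^2 (1 + 2 d) <= 1 + 6 d < (1 + 100 d) (1 - 2 d)]. *)
rewrite lte_fin mulrA ltr_pdivrMr ?subr_gt0// -mulr_natl.
have : (1 + d) * ((1 + d) * (1 + 2 * d)) <= 1 + 6 * d by nra.
have : 1 + 6 * d < (1 + h) * (1 - 2 * d) by rewrite dh; nra.
have : (1 + h) * (1 - 2 * d) <= (1 + eps) * (1 - 2 * d).
  by rewrite ler_wpM2r ?lerD2l//; lra.
by lra.
Qed.
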